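(* Let $S$ be an orientable surface, possibly with punctures. For every integer $n\ge 3$, the (full) braid group $B_n(S)$ of the surface $S$ is not residually free.
   Context: Surfaces are connected and without boundary. For a surface $S$, let \[F(S,n)=\{(x_1,\dots,x_n)\in S^{\times n}\mid x_i\neq x_j\text{ if } i\neq j\}\] be the configuration space of $n$ distinct ordered points in $S$. The symmetric group $\Sigma_n$ acts on $F(S,n)$ by permuting coordinates, and the full braid group of $S$ is the fundamental group of the orbit space, $B_n(S)=\pi_1(F(S,n)/\Sigma_n)$. A group $G$ is residually free if for every $x\neq 1$ in $G$ there is a homomorphism $f$ from $G$ to a free group $F$ with $f(x)\neq 1$. *)

(* Defs.v *)
From HB Require Import structures.
From mathcomp Require Import all_boot all_order all_algebra all_fingroup generic_quotient.
From mathcomp Require Import all_classical all_reals all_analysis homotopy.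
From mathcomp Require Import ring lra.

Set Implicit Arguments.
Unset Strict Implicit.
Unset Printing Implicit Defensive.

Import Order.TTheory GRing.Theory Num.Theory.
Import numFieldNormedType.Exports.

Local Open Scope classical_set_scope.
Local Open Scope ring_scope.
Local Open Scope quotient_scope.

Definition unit_interval (R : realType) : Type := `[0 : R, 1]%classic.

Section unit_interval.
Variable R : realType.
Local Notation I := (unit_interval R).

HB.instance Definition _ := Topological.on I.

Lemma clamp_subproof (t : R) : Num.max 0 (Num.min 1 t) \in `[0 : R, 1]%classic.
Proof.
by rewrite inE /= in_itv /= le_max lexx /= ge_max ler01 ge_min lexx.
Qed.

(* The retraction of the line onto the unit interval: it lets the usual
   formulas for paths be written without membership proofs. *)
Definition clamp (t : R) : I := exist (fun x => x \in _) _ (clamp_subproof t).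

Lemma itv_ge0 (t : I) : 0 <= val t.
Proof. by case: t => t /= /set_mem /=; rewrite in_itv /= => /andP[]. Qed.

Lemma itv_le1 (t : I) : val t <= 1.
Proof. by case: t => t /= /set_mem /=; rewrite in_itv /= => /andP[]. Qed.

Lemma val_clamp (t : R) : 0 <= t <= 1 -> val (clamp t) = t.
Proof.
by case/andP=> t0 t1 /=; rewrite (min_idPr t1) (max_idPr t0).
Qed.

Lemma clampK (t : I) : clamp (val t) = t.
Proof. by apply: val_inj; rewrite val_clamp // itv_ge0 itv_le1. Qed.

Lemma clamp_le0 (t : R) : t <= 0 -> clamp t = clamp 0.
Proof.
move=> t0; apply: val_inj => /=.
have t1 : t <= 1 by apply: le_trans t0 ler01.
by rewrite (min_idPr t1) (max_idPl t0) (min_idPr ler01) maxxx.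
Qed.

Lemma clamp_ge1 (t : R) : 1 <= t -> clamp t = clamp 1.
Proof. by move=> t1; apply: val_inj => /=; rewrite (min_idPl t1) minxx. Qed.

Lemma clamp0_neq_clamp1 : clamp 0 != clamp 1.
Proof.
apply/eqP => /(congr1 val); rewrite !val_clamp ?lexx ?ler01 // => /eqP.
by rewrite eq_sym oner_eq0.
Qed.

HB.instance Definition _ := isBiPointed.Build I clamp0_neq_clamp1.

Lemma zeroE : zero = clamp 0 :> I. Proof. by []. Qed.
Lemma oneE : one = clamp 1 :> I. Proof. by []. Qed.

Lemma val_itv_continuous : continuous (val : I -> R).
Proof. exact: initial_continuous. Qed.

Lemma clamp_continuous : continuous clamp.
Proof.
apply: continuous_comp_initial => t.
apply: continuous_max; first exact: cst_continuous.
by apply: continuous_min; [exact: cst_continuous|exact: id].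
Qed.

Lemma pasting (Z X : topologicalType) (a : Z -> R) (c : R) (u v : Z -> X) :
  continuous a -> continuous u -> continuous v ->
  (forall z, a z = c -> u z = v z) ->
  continuous (fun z => if a z <= c then u z else v z).
Proof.
move=> ca cu cv uv z U /= nU.
change (nbhs z [set z' | U (if a z' <= c then u z' else v z')]).
have [ac|ac|ac] := ltgtP (a z) c.
- have nlt : nbhs (a z) [set r | r < c].
    by apply: open_nbhs_nbhs; split => //; exact: open_lt.
  rewrite (ltW ac) in nU.
  apply: (filterS _ (filterI (cu z U nU : nbhs z (u @^-1` U)) (ca z _ nlt : nbhs z (a @^-1` _)))) => z' [/= Uz azc].
  by rewrite (ltW azc).
- have ngt : nbhs (a z) [set r | c < r].
    by apply: open_nbhs_nbhs; split => //; exact: open_gt.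
  rewrite leNgt ac /= in nU.
  apply: (filterS _ (filterI (cv z U nU : nbhs z (v @^-1` U)) (ca z _ ngt : nbhs z (a @^-1` _)))) => z' [/= Uz azc].
  by rewrite leNgt azc.
- rewrite ac lexx in nU.
  have nv : nbhs (v z) U by rewrite -uv.
  apply: (filterS _ (filterI (cu z U nU : nbhs z (u @^-1` U)) (cv z U nv : nbhs z (v @^-1` U)))) => z' [/= Uz Vz].
  by case: ifP.
Qed.

End unit_interval.

Section paths.
Variables (R : realType) (X : topologicalType).
Local Notation I := (unit_interval R).
Implicit Types x y z w : X.

Lemma path_continuous x y (p : {path I from x to y}) : continuous p.
Proof. exact: cts_fun. Qed.

Lemma path_clamp0 x y (p : {path I from x to y}) (t : R) :
  t <= 0 -> p (clamp t) = x.
Proof. by move=> /clamp_le0 ->; exact: path_zero. Qed.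

Lemma path_clamp1 x y (p : {path I from x to y}) (t : R) :
  1 <= t -> p (clamp t) = y.
Proof. by move=> /clamp_ge1 ->; exact: path_one. Qed.

Lemma continuous_clamp (Z Y : topologicalType) (a : Z -> R) (f : I -> Y) :
  continuous a -> continuous f -> continuous (fun e => f (clamp (a e))).
Proof.
move=> ca cf e; apply: continuous_comp; last exact: cf.
by apply: continuous_comp; [exact: ca|exact: clamp_continuous].
Qed.

Lemma affine_continuous (Z : topologicalType) (a : Z -> R) (k c : R) :
  continuous a -> continuous (fun e => k * a e + c).
Proof.
move=> ca e; apply: cvgD; last exact: cvg_cst.
by apply: cvgM; [exact: cvg_cst|exact: ca].
Qed.

Definition concat_fun x y z (p : {path I from x to y})
    (q : {path I from y to z}) (s : I) : X :=
  if val s <= 2^-1 then p (clamp (2 * val s)) else q (clamp (2 * val s - 1)).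

Section concat.
Variables (x y z : X) (p : {path I from x to y}) (q : {path I from y to z}).

Lemma concat_fun_continuous : continuous (concat_fun p q).
Proof.
apply: (@pasting R I X val 2^-1 (fun s => p (clamp (2 * val s)))
          (fun s => q (clamp (2 * val s - 1)))).
- exact: val_itv_continuous.
- apply: continuous_clamp; last exact: path_continuous.
  by have := affine_continuous (k := 2) (c := 0) (@val_itv_continuous R);
     under eq_fun do rewrite addr0.
- apply: continuous_clamp; last exact: path_continuous.
  exact: affine_continuous (@val_itv_continuous R).
- move=> s ->; rewrite path_clamp1 ?path_clamp0 //; lra.
Qed.

Lemma concat_fun_zero : concat_fun p q zero = x.
Proof.
rewrite /concat_fun zeroE val_clamp ?lexx ?ler01 //.
by rewrite invr_ge0 ler0n path_clamp0 // mulr0.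
Qed.

Lemma concat_fun_one : concat_fun p q one = z.
Proof.
rewrite /concat_fun oneE val_clamp ?lexx ?ler01 //.
by rewrite ifF ?path_clamp1 //; lra.
Qed.

Definition concat : {path I from x to z} :=
  mk_path concat_fun_continuous concat_fun_zero concat_fun_one.

End concat.

Section reverse.
Variables (x y : X) (p : {path I from x to y}).

Definition reverse_fun (s : I) : X := p (clamp (1 - val s)).

Lemma reverse_fun_continuous : continuous reverse_fun.
Proof.
apply: continuous_clamp; last exact: path_continuous.
have := affine_continuous (k := -1) (c := 1) (@val_itv_continuous R).
by under eq_fun do rewrite mulN1r addrC.
Qed.

Lemma reverse_fun_zero : reverse_fun zero = y.
Proof.
by rewrite /reverse_fun path_clamp1 // zeroE val_clamp ?lexx ?ler01 // subr0.
Qed.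

Lemma reverse_fun_one : reverse_fun one = x.
Proof.
by rewrite /reverse_fun path_clamp0 // oneE val_clamp ?lexx ?ler01 // subrr.
Qed.

Definition reverse : {path I from y to x} :=
  mk_path reverse_fun_continuous reverse_fun_zero reverse_fun_one.

End reverse.

Definition constant_path x : {path I from x to x} := cst x.

Definition homotopic x y (p q : {path I from x to y}) : Prop :=
  exists H : I * I -> X, [/\ continuous H,
    forall s, H (s, zero) = p s,
    forall s, H (s, one) = q s &
    forall t, H (zero, t) = x /\ H (one, t) = y].

End paths.
Section homotopy.
Variables (R : realType) (X : topologicalType).
Local Notation I := (unit_interval R).
Implicit Types x y z w : X.

Lemma val_zero : val (zero : I) = 0.
Proof. by rewrite zeroE val_clamp ?lexx ?ler01. Qed.

Lemma val_one : val (one : I) = 1.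
Proof. by rewrite oneE val_clamp ?lexx ?ler01. Qed.

Lemma clamp0 : clamp 0 = zero :> I. Proof. by []. Qed.
Lemma clamp1 : clamp 1 = one :> I. Proof. by []. Qed.

Lemma itv_fst_continuous : continuous (fun e : I * I => val e.1).
Proof.
move=> e; apply: (@continuous_comp _ _ _ fst (val : I -> R));
  [exact: cvg_fst|exact: val_itv_continuous].
Qed.

Lemma itv_snd_continuous : continuous (fun e : I * I => val e.2).
Proof.
move=> e; apply: (@continuous_comp _ _ _ snd (val : I -> R));
  [exact: cvg_snd|exact: val_itv_continuous].
Qed.

Lemma continuous_pair (Z Y W : topologicalType) (f : Z -> Y) (g : Z -> W) :
  continuous f -> continuous g -> continuous (fun e => (f e, g e)).
Proof. by move=> cf cg e; apply: cvg_pair; [exact: cf|exact: cg]. Qed.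

Lemma continuous_clampr (Z : topologicalType) (a : Z -> R) :
  continuous a -> continuous (fun e => clamp (a e)).
Proof.
move=> ca e; apply: (@continuous_comp _ _ _ a (@clamp R)); first exact: ca.
exact: clamp_continuous.
Qed.

(* Two reparametrizations of one path with the same end points are
   homotopic, by linear interpolation of the parameters. *)
Lemma homotopic_reparam x y (h : I -> X) (p q : {path I from x to y})
    (f g : I -> R) :
  continuous h -> continuous f -> continuous g ->
  (forall s, p s = h (clamp (f s))) -> (forall s, q s = h (clamp (g s))) ->
  f zero = g zero -> f one = g one -> homotopic p q.
Proof.
move=> ch cf cg pE qE fg0 fg1.
exists (fun e => h (clamp (f e.1 + val e.2 * (g e.1 - f e.1)))); split.
- apply: continuous_clamp => // e.
  have cf1 : {for e, continuous (fun e : I * I => f e.1)}.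
    by apply: (@continuous_comp _ _ _ fst f); [exact: cvg_fst|exact: cf].
  have cg1 : {for e, continuous (fun e : I * I => g e.1)}.
    by apply: (@continuous_comp _ _ _ fst g); [exact: cvg_fst|exact: cg].
  apply: cvgD; first exact: cf1.
  apply: cvgM; first exact: itv_snd_continuous.
  by apply: cvgB; [exact: cg1|exact: cf1].
- by move=> s; rewrite val_zero mul0r addr0 pE.
- by move=> s; rewrite val_one mul1r addrC subrK qE.
- move=> t; rewrite /= fg0 fg1 !subrr !mulr0 !addr0 -!qE.
  by rewrite path_zero path_one.
Qed.

Lemma homotopic_refl x y (p : {path I from x to y}) : homotopic p p.
Proof.
have pK s : p s = p (clamp (val s)) by rewrite clampK.
have cv := @val_itv_continuous R.
exact: (homotopic_reparam (@path_continuous _ _ _ _ p) cv cv pK pK).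
Qed.

Lemma homotopic_sym x y (p q : {path I from x to y}) :
  homotopic p q -> homotopic q p.
Proof.
case=> H [cH H0 H1 Hx]; exists (fun e => H (e.1, clamp (1 - val e.2))); split.
- move=> e; apply: (@continuous_comp _ _ _ _ H); last exact: cH.
  apply: (@continuous_pair (I * I)%type I I fst (fun e => clamp (1 - val e.2))).
    by move=> ?; exact: cvg_fst.
  apply: continuous_clampr => e'; apply: cvgB; first exact: cvg_cst.
  exact: itv_snd_continuous.
- by move=> s; rewrite val_zero subr0.
- by move=> s; rewrite val_one subrr.
- by move=> t; exact: Hx.
Qed.

Lemma homotopic_trans x y (p q r : {path I from x to y}) :
  homotopic p q -> homotopic q r -> homotopic p r.
Proof.
case=> H [cH H0 H1 Hx] [K [cK K0 K1 Kx]].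
exists (fun e => if val e.2 <= 2^-1 then H (e.1, clamp (2 * val e.2))
                 else K (e.1, clamp (2 * val e.2 - 1))); split.
- apply: (@pasting R (I * I)%type X (fun e => val e.2) 2^-1
    (fun e => H (e.1, clamp (2 * val e.2)))
    (fun e => K (e.1, clamp (2 * val e.2 - 1)))).
  + exact: itv_snd_continuous.
  + move=> e; apply: (@continuous_comp _ _ _ _ H); last exact: cH.
    apply: (@continuous_pair (I * I)%type I I fst (fun e => clamp (2 * val e.2))).
      by move=> ?; exact: cvg_fst.
    apply: continuous_clampr => e'; apply: cvgM; first exact: cvg_cst.
    exact: itv_snd_continuous.
  + move=> e; apply: (@continuous_comp _ _ _ _ K); last exact: cK.
    apply: (@continuous_pair (I * I)%type I I fst
              (fun e => clamp (2 * val e.2 - 1))).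
      by move=> ?; exact: cvg_fst.
    by apply: continuous_clampr; apply: affine_continuous itv_snd_continuous.
  + move=> e ->; rewrite mulfV ?pnatr_eq0 // subrr.
    by rewrite clamp0 clamp1 H1 K0.
- by move=> s; rewrite val_zero ifT ?invr_ge0 ?ler0n // mulr0 clamp0.
- move=> s; rewrite val_one ifF; last lra.
  by rewrite (_ : 2 * 1 - 1 = 1 :> R) ?clamp1 //; lra.
- by move=> t /=; case: ifP => _; [exact: Hx|exact: Kx].
Qed.

Lemma homotopic_concat x y z (p p' : {path I from x to y})
    (q q' : {path I from y to z}) :
  homotopic p p' -> homotopic q q' -> homotopic (concat p q) (concat p' q').
Proof.
case=> H [cH H0 H1 Hx] [K [cK K0 K1 Kx]].
exists (fun e => if val e.1 <= 2^-1 then H (clamp (2 * val e.1), e.2)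
                 else K (clamp (2 * val e.1 - 1), e.2)); split.
- apply: (@pasting R (I * I)%type X (fun e => val e.1) 2^-1
    (fun e => H (clamp (2 * val e.1), e.2))
    (fun e => K (clamp (2 * val e.1 - 1), e.2))).
  + exact: itv_fst_continuous.
  + move=> e; apply: (@continuous_comp _ _ _ _ H); last exact: cH.
    apply: (@continuous_pair (I * I)%type I I (fun e => clamp (2 * val e.1)) snd).
      apply: continuous_clampr => e'; apply: cvgM; first exact: cvg_cst.
      exact: itv_fst_continuous.
    by move=> ?; exact: cvg_snd.
  + move=> e; apply: (@continuous_comp _ _ _ _ K); last exact: cK.
    apply: (@continuous_pair (I * I)%type I I
              (fun e => clamp (2 * val e.1 - 1)) snd).
      by apply: continuous_clampr; apply: affine_continuous itv_fst_continuous.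
    by move=> ?; exact: cvg_snd.
  + move=> e ->; rewrite mulfV ?pnatr_eq0 // subrr clamp0 clamp1.
    by rewrite (Hx _).2 (Kx _).1.
- by move=> s; rewrite /concat/= /mk_path /concat_fun H0 K0.
- by move=> s; rewrite /concat/= /mk_path /concat_fun H1 K1.
- move=> t; rewrite val_zero ifT ?invr_ge0 ?ler0n // mulr0 clamp0 (Hx _).1.
  split => //; rewrite val_one ifF; last lra.
  by rewrite (_ : 2 * 1 - 1 = 1 :> R) ?clamp1 ?(Kx _).2 //; lra.
Qed.

Lemma homotopic_reverse x y (p q : {path I from x to y}) :
  homotopic p q -> homotopic (reverse p) (reverse q).
Proof.
case=> H [cH H0 H1 Hx]; exists (fun e => H (clamp (1 - val e.1), e.2)); split.
- move=> e; apply: (@continuous_comp _ _ _ _ H); last exact: cH.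
  apply: (@continuous_pair (I * I)%type I I (fun e => clamp (1 - val e.1)) snd).
    apply: continuous_clampr => e'; apply: cvgB; first exact: cvg_cst.
    exact: itv_fst_continuous.
  by move=> ?; exact: cvg_snd.
- by move=> s; exact: H0.
- by move=> s; exact: H1.
- by move=> t; rewrite val_zero val_one subr0 subrr; have [] := Hx t.
Qed.

Lemma concatE x y z (p : {path I from x to y}) (q : {path I from y to z})
    (s : I) :
  concat p q s =
  if val s <= 2^-1 then p (clamp (2 * val s)) else q (clamp (2 * val s - 1)).
Proof. by []. Qed.

Lemma reverseE x y (p : {path I from x to y}) (s : I) :
  reverse p s = p (clamp (1 - val s)).
Proof. by []. Qed.

Lemma shift_continuous (k c : R) : continuous (fun s : I => k * val s + c).
Proof. exact: affine_continuous (@val_itv_continuous R). Qed.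

Lemma scale_continuous (k : R) : continuous (fun s : I => k * val s).
Proof. by have := @shift_continuous k 0; under eq_fun do rewrite addr0. Qed.

Lemma minr_continuous (f g : I -> R) : continuous f -> continuous g ->
  continuous (fun s => Num.min (f s) (g s)).
Proof. by move=> cf cg s; apply: (@continuous_min R I f g s); [exact: cf|exact: cg]. Qed.

Lemma maxr_continuous (f g : I -> R) : continuous f -> continuous g ->
  continuous (fun s => Num.max (f s) (g s)).
Proof. by move=> cf cg s; apply: (@continuous_max R I f g s); [exact: cf|exact: cg]. Qed.

Lemma homotopic_const_concat x y (p : {path I from x to y}) :
  homotopic (concat (constant_path R x) p) p.
Proof.
apply: (@homotopic_reparam _ _ p _ _
  (fun s => Num.max 0 (2 * val s - 1)) val).
- exact: path_continuous.
- apply: (@maxr_continuous (cst 0)); last exact: shift_continuous.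
  exact: cst_continuous.
- exact: val_itv_continuous.
- move=> s; rewrite concatE; case: (leP (val s)) => s2.
    by rewrite max_l ?clamp0 ?path_zero //; lra.
  by rewrite max_r //; lra.
- by move=> s; rewrite clampK.
- by rewrite val_zero max_l //; lra.
- by rewrite val_one max_r //; lra.
Qed.

Lemma homotopic_concat_const x y (p : {path I from x to y}) :
  homotopic (concat p (constant_path R y)) p.
Proof.
apply: (@homotopic_reparam _ _ p _ _
  (fun s => Num.min 1 (2 * val s)) val).
- exact: path_continuous.
- apply: (@minr_continuous (cst 1)); last exact: scale_continuous.
  exact: cst_continuous.
- exact: val_itv_continuous.
- move=> s; rewrite concatE; case: (leP (val s)) => s2.
    by rewrite min_r //; lra.
  by rewrite min_l ?clamp1 ?path_one //; lra.
- by move=> s; rewrite clampK.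
- by rewrite val_zero min_r //; lra.
- by rewrite val_one min_l //; lra.
Qed.

Lemma homotopic_concat_reverse x y (p : {path I from x to y}) :
  homotopic (concat p (reverse p)) (constant_path R x).
Proof.
apply: (@homotopic_reparam _ _ p _ _
  (fun s => Num.min (2 * val s) (- 2 * val s + 2)) (cst 0)).
- exact: path_continuous.
- exact: minr_continuous (@scale_continuous _) (@shift_continuous _ _).
- exact: cst_continuous.
- move=> s; rewrite concatE; case: (leP (val s)) => s2.
    by rewrite min_l //; lra.
  rewrite min_r ?reverseE; last lra.
  rewrite val_clamp; last by have := itv_le1 s; lra.
  by congr (p (clamp _)); lra.
- by move=> s; rewrite /= clamp0 path_zero.
- by rewrite val_zero min_l //= ; lra.
- by rewrite val_one min_r /=; lra.
Qed.

Lemma homotopic_reverse_concat x y (p : {path I from x to y}) :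
  homotopic (concat (reverse p) p) (constant_path R y).
Proof.
apply: (@homotopic_reparam _ _ p _ _
  (fun s => Num.max (- 2 * val s + 1) (2 * val s - 1)) (cst 1)).
- exact: path_continuous.
- exact: maxr_continuous (@shift_continuous _ _) (@shift_continuous _ _).
- exact: cst_continuous.
- move=> s; rewrite concatE; case: (leP (val s)) => s2.
    rewrite max_l ?reverseE; last lra.
    rewrite val_clamp; last by have := itv_ge0 s; lra.
    by congr (p (clamp _)); lra.
  by rewrite max_r //; lra.
- by move=> s; rewrite /= clamp1 path_one.
- by rewrite val_zero max_l //= ; lra.
- by rewrite val_one max_r /=; lra.
Qed.

Lemma homotopic_concatA x y z w (p : {path I from x to y})
    (q : {path I from y to z}) (r : {path I from z to w}) :
  homotopic (concat p (concat q r)) (concat (concat p q) r).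
Proof.
apply: (@homotopic_reparam _ _ (concat p (concat q r)) _ _ val
  (fun s => Num.min (2 * val s)
              (Num.min (1 * val s + 4^-1) (2^-1 * val s + 2^-1)))).
- exact: path_continuous.
- exact: val_itv_continuous.
- apply: minr_continuous (@scale_continuous _) _.
  exact: minr_continuous (@shift_continuous _ _) (@shift_continuous _ _).
- by move=> s; rewrite clampK.
- move=> s; have s0 := itv_ge0 s; have s1 := itv_le1 s.
  rewrite [LHS]concatE; case: (leP (val s)) => s2.
    rewrite concatE val_clamp; last lra.
    case: (leP (2 * val s)) => s4.
      rewrite [Num.min (2 * val s) _]min_l; last by rewrite le_min; lra.
      by rewrite concatE val_clamp ?s4 //; lra.
    rewrite [Num.min (2 * val s) _]min_r; last by rewrite ge_min; lra.
    rewrite min_l; last lra.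
    rewrite concatE val_clamp; last lra.
    rewrite ifF; last lra.
    rewrite concatE val_clamp; last lra.
    rewrite ifT; last lra.
    by congr (q (clamp _)); lra.
  rewrite [Num.min (2 * val s) _]min_r; last by rewrite ge_min; lra.
  rewrite min_r; last lra.
  rewrite concatE val_clamp; last lra.
  rewrite ifF; last lra.
  rewrite concatE val_clamp; last lra.
  rewrite ifF; last lra.
  by congr (r (clamp _)); lra.
- by rewrite val_zero min_l ?mulr0 // le_min; lra.
- by rewrite val_one min_r ?min_r ?ge_min; lra.
Qed.

End homotopy.

Section fundamental_group.
Variables (R : realType) (X : topologicalType) (x : X).
Local Notation I := (unit_interval R).
Local Notation loop := {path I from x to x}.

Definition homotopicb (p q : loop) : bool := `[< homotopic p q >].

Lemma homotopicb_refl : reflexive homotopicb.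
Proof. by move=> p; apply/asboolP; exact: homotopic_refl. Qed.

Lemma homotopicb_sym : symmetric homotopicb.
Proof.
by move=> p q; apply/asboolP/asboolP; exact: homotopic_sym.
Qed.

Lemma homotopicb_trans : transitive homotopicb.
Proof.
move=> q p r /asboolP pq /asboolP qr; apply/asboolP.
exact: homotopic_trans pq qr.
Qed.

Definition homotopic_equiv :=
  EquivRel _ homotopicb_refl homotopicb_sym homotopicb_trans.

Definition fundamental_group : Type := {eq_quot homotopic_equiv}.
Local Notation pi1 := fundamental_group.

HB.instance Definition _ := Choice.on pi1.
HB.instance Definition _ := Quotient.on pi1.

Lemma loop_class_eqP (p q : loop) :
  \pi_pi1 p = \pi_pi1 q <-> homotopic p q.
Proof.
by split=> [/eqmodP/asboolP|pq]; last exact/eqmodP/asboolP.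
Qed.

Lemma homotopic_repr (p : loop) : homotopic (repr (\pi_pi1 p)) p.
Proof. by apply/loop_class_eqP; rewrite reprK. Qed.

Definition pi1_one : pi1 := \pi_pi1 (constant_path R x).
Definition pi1_inv (a : pi1) : pi1 := \pi_pi1 (reverse (repr a)).
Definition pi1_mul (a b : pi1) : pi1 := \pi_pi1 (concat (repr a) (repr b)).

Lemma pi1_mulE (p q : loop) :
  pi1_mul (\pi_pi1 p) (\pi_pi1 q) = \pi_pi1 (concat p q).
Proof.
by apply/loop_class_eqP/homotopic_concat; exact: homotopic_repr.
Qed.

Lemma pi1_invE (p : loop) : pi1_inv (\pi_pi1 p) = \pi_pi1 (reverse p).
Proof. by apply/loop_class_eqP/homotopic_reverse; exact: homotopic_repr. Qed.

Lemma pi1_mulA : associative pi1_mul.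
Proof.
elim/quotW=> p; elim/quotW=> q; elim/quotW=> r.
rewrite (pi1_mulE q r) (pi1_mulE p q) !pi1_mulE.
by apply/loop_class_eqP; exact: homotopic_concatA.
Qed.

Lemma pi1_mul1 : left_id pi1_one pi1_mul.
Proof.
elim/quotW=> p; rewrite pi1_mulE.
by apply/loop_class_eqP; exact: homotopic_const_concat.
Qed.

Lemma pi1_mulr1 : right_id pi1_one pi1_mul.
Proof.
elim/quotW=> p; rewrite pi1_mulE.
by apply/loop_class_eqP; exact: homotopic_concat_const.
Qed.

Lemma pi1_mulV : left_inverse pi1_one pi1_inv pi1_mul.
Proof.
elim/quotW=> p; rewrite pi1_invE pi1_mulE.
by apply/loop_class_eqP; exact: homotopic_reverse_concat.
Qed.

Lemma pi1_mulrV : right_inverse pi1_one pi1_inv pi1_mul.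
Proof.
elim/quotW=> p; rewrite pi1_invE pi1_mulE.
by apply/loop_class_eqP; exact: homotopic_concat_reverse.
Qed.

HB.instance Definition _ := isGroup.Build pi1
  pi1_mulA pi1_mul1 pi1_mulr1 pi1_mulV pi1_mulrV.

End fundamental_group.

Section configurations.
Variables (S : topologicalType) (n : nat).

Definition distinct_points : set {ptws 'I_n -> S} :=
  [set x | forall i j, i <> j -> x i <> x j].

Definition configuration_space : Type := distinct_points.
HB.instance Definition _ := Topological.on configuration_space.

Definition same_orbit (x y : configuration_space) : bool :=
  `[< exists s : 'S_n, forall i, val y i = val x (s i) >].

Lemma same_orbit_refl : reflexive same_orbit.
Proof. by move=> x; apply/asboolP; exists 1%g => i; rewrite perm1. Qed.

Lemma same_orbit_sym : symmetric same_orbit.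
Proof.
move=> x y; apply/asboolP/asboolP => -[s xy]; exists s^-1%g => i;
  by rewrite xy permKV.
Qed.

Lemma same_orbit_trans : transitive same_orbit.
Proof.
move=> y x z /asboolP[s xy] /asboolP[t yz]; apply/asboolP.
by exists (t * s)%g => i; rewrite yz xy permM.
Qed.

Definition same_orbit_equiv :=
  EquivRel _ same_orbit_refl same_orbit_sym same_orbit_trans.

Definition orbit_space : Type :=
  quotient_topology {eq_quot same_orbit_equiv}.
HB.instance Definition _ := Topological.on orbit_space.
HB.instance Definition _ := Quotient.on orbit_space.

End configurations.

(* The isomorphism type does not depend on the base point when [S] is a
   surface, the orbit space being then path connected. *)
Definition surface_braid_group (R : realType) (S : topologicalType) (n : nat)
    (x : orbit_space S n) : groupType :=
  fundamental_group R x.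

(* The universal property of the free group [F] with basis the family [i]. *)
Definition free_on (F : groupType) (B : Type) (i : B -> F) : Prop :=
  forall (H : groupType) (g : B -> H),
    exists f : {multiplicative F -> H},
      (forall b, f (i b) = g b) /\
      (forall f' : {multiplicative F -> H},
         (forall b, f' (i b) = g b) -> forall a, f' a = f a).

Definition free_group (F : groupType) : Prop :=
  exists (B : Type) (i : B -> F), free_on i.

Definition residually_free (G : groupType) : Prop :=
  forall x : G, x <> 1%g ->
    exists (F : groupType) (f : {multiplicative G -> F}),
      free_group F /\ f x <> 1%g.

Section surfaces.
Variable R : realType.
Local Notation plane := (R * R)%type.

(* A homeomorphism between an open set of [S] and an open set of the plane;
   the two maps are unconstrained outside these open sets. *)
Record chart (S : topologicalType) := Chart {
  chart_dom : set S;
  to_plane : S -> plane;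
  from_plane : plane -> S;
  chart_dom_open : open chart_dom;
  chart_im_open : open (to_plane @` chart_dom);
  to_planeK : forall x, chart_dom x -> from_plane (to_plane x) = x;
  to_plane_continuous : {within chart_dom, continuous to_plane};
  from_plane_continuous :
    {within to_plane @` chart_dom, continuous from_plane}
}.

(* Compactness is not assumed: a surface with punctures is again a surface. *)
Record surface (S : topologicalType) : Prop := Surface {
  surface_hausdorff : hausdorff_space S;
  surface_second_countable : @second_countable S;
  surface_connected : connected [set: S];
  surface_charts : forall x : S, exists c : chart S, chart_dom c x
}.

Definition polar (r t : R) : plane := (r * cos t, r * sin t).

(* The loop [g] has winding number 1 around [q]: a continuous determination of
   the angle along [g], seen from [q], increases by [2 * pi]. *)
Definition winds_once (g : R -> plane) (q : plane) : Prop :=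
  exists rho theta : R -> R,
    [/\ {within `[0, 1], continuous theta},
        forall t, 0 <= t <= 1 -> 0 < rho t /\ g t = q + polar (rho t) (theta t) &
        theta 1 - theta 0 = 2 * pi].

(* Local degree 1: small positively oriented circles around [p] are mapped to
   loops of winding number 1 around [h p]. *)
Definition orientation_preserving_at (h : plane -> plane) (p : plane) : Prop :=
  \forall r \near 0^'+,
    winds_once (fun t => h (p + polar r (2 * pi * t))) (h p).

Definition orientable (S : topologicalType) : Prop :=
  exists A : set (chart S),
    (forall x, exists2 c, A c & chart_dom c x) /\
    (forall c d x, A c -> A d -> chart_dom c x -> chart_dom d x ->
       orientation_preserving_at (to_plane d \o from_plane c) (to_plane c x)).

End surfaces.

(* Main.v *)
Require Import Defs.
From HB Require Import structures.
From mathcomp Require Import all_boot all_order all_algebra.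
From mathcomp Require Import all_fingroup generic_quotient.
From mathcomp Require Import all_classical all_reals all_analysis homotopy.
From mathcomp Require Import zify ring lra.

(** The group contains elements [a] and [b] with [a ^+ 2 = b ^+ 3] that do not
commute, while in a free group this equation forces [a] and [b] to commute; so
every morphism to a free group kills their commutator.

Geometry ([rotating], [half_turn_third_turn]).  Put three of the points in a
disc: a center and two antipodal points, placed symmetrically.  Half a turn of
the disc preserves this set of three points and is the loop [a].  Deform the
three points into an equilateral triangle, symmetrically about a line through
the center: a third of a turn of the triangle, conjugated by the deformation, is
the loop [b].  Both [a ^+ 2] and [b ^+ 3] are a full turn, of the collinear
triple and of the triangle; turning all the intermediate triples is a homotopy
between the two.  For the plane these are the classical generators of the braid
group on three strands as a torus knot group.

Non-commutation ([permutes_unique], [swap_cycle_neq]).  The ordered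
configuration space covers the orbit space, so a loop induces a well defined
permutation of the points ([monodromy]).  Here [a] induces a transposition and
[b] a 3-cycle, which do not commute.

Base point ([reachable_complement], [move_point]).  A connected surface minus a
finite set is path connected, so the points of any configuration can be moved
one at a time into the disc.

Algebra ([free_sq_cube_commute]).  For every large enough prime [p], a given
nontrivial element of a free group survives in a group of unitriangular matrices
over the field with [p] elements: a representation in the style of Magnus,
adapted to the reduced word [b_1 ^ k_1 ... b_m ^ k_m], sends it to a matrix with
corner entry [k_1 * ... * k_m].  In such a group the order of an element [y] is a
power of [p], hence prime to 3, so that [y] is a power of [y ^+ 3]; when
[x ^+ 2 = y ^+ 3], it therefore commutes with [x]. *)

Set Implicit Arguments.
Unset Strict Implicit.
Unset Printing Implicit Defensive.

Import Order.TTheory GRing.Theory Num.Theory.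
Import numFieldNormedType.Exports.

(** * Equations in free groups *)

Local Open Scope group_scope.

(** The elements that preserve [P] under left multiplication, together with their
inverses, form a subgroup, whatever [P] is. *)
Section left_stabilizer.
Variables (F : groupType) (P : F -> Prop).

Definition stabilizes (a : F) : bool :=
  `[< forall x, P x -> P (a * x) /\ P (a^-1 * x) >].

Lemma stabilizes_closed : group_closed stabilizes.
Proof.
split=> [|a b /asboolP aP /asboolP bP]; apply/asboolP => x Px.
  by rewrite invg1 mul1g.
by rewrite invMg invgK -!mulgA; split;
  [case: (aP _ (bP _ Px).2)|case: (bP _ (aP _ Px).2)].
Qed.

Definition left_stabilizer := {a : F | stabilizes a}.
HB.instance Definition _ := SubChoice.on left_stabilizer.
HB.instance Definition _ :=
  SubChoice_isSubGroup.Build F stabilizes left_stabilizer stabilizes_closed.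

End left_stabilizer.

(** A free group is generated by its basis.  The basis lands in the subgroup
[left_stabilizer P], hence extends to a morphism into it; composed with the
inclusion, this morphism fixes the basis, so it is the identity by uniqueness. *)
Lemma free_ind (F : groupType) (B : Type) (i : B -> F) (P : F -> Prop) :
  free_on i -> P 1 ->
  (forall b x, P x -> P (i b * x) /\ P ((i b)^-1 * x)) -> forall x, P x.
Proof.
move=> Ffree P1 Pi x.
have iP b : stabilizes P (i b) by apply/asboolP => y; exact: Pi.
have [f [fi _]] := Ffree (left_stabilizer P) (fun b => Sub (i b) (iP b)).
have [g [_ gE]] := Ffree F i.
(* [g] mediates between the two morphisms to which uniqueness applies. *)
have fx : val (f x) = x.
  transitivity (g x).
    by apply: (gE (val \o f)) => b /=; rewrite fi SubK.
  by rewrite -(gE idfun).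
have /asboolP/(_ 1 P1)[] := valP (f x).
by rewrite fx mulg1.
Qed.

Section integer_powers.
Variable G : groupType.

Definition zpow (x : G) (k : int) : G :=
  match k with Posz n => x ^+ n | Negz n => x ^- n.+1 end.

Lemma zpowS x k : x * zpow x k = zpow x (1 + k)%R.
Proof.
case: k => n /=; first by rewrite -expgS.
case: n => [|n]; first by rewrite mulgV.
have -> : (1 + Negz n.+1)%R = Negz n by lia.
by rewrite [x ^+ n.+2]expgSr invMg mulKVg.
Qed.

Lemma zpowP x k : x^-1 * zpow x k = zpow x (- 1 + k)%R.
Proof.
have {1}-> : k = (1 + (- 1 + k))%R by lia.
by rewrite -zpowS mulKg.
Qed.

End integer_powers.

Section multiplicative_maps.
Variables (G H : groupType) (f : {multiplicative G -> H}).

Lemma multiplicative1 : f 1 = 1.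
Proof. by apply: (mulgI (f 1)); rewrite -gmulfM !mulg1. Qed.

Lemma multiplicativeV x : f x^-1 = (f x)^-1.
Proof. by apply: (mulgI (f x)); rewrite -gmulfM !mulgV multiplicative1. Qed.

Lemma multiplicativeX x n : f (x ^+ n) = f x ^+ n.
Proof.
by elim: n => [|n IH]; rewrite ?multiplicative1 // !expgS gmulfM IH.
Qed.

Lemma multiplicative_zpow x k : f (zpow x k) = zpow (f x) k.
Proof. by case: k => n; rewrite /= ?multiplicativeV multiplicativeX. Qed.

End multiplicative_maps.

Section reduced_words.
Variable B : Type.
Implicit Types w : seq (B * int).

(** The syllable [(b, k)] stands for the [k]-th power of the generator [b].  A
reduced word has nonzero exponents and no two consecutive syllables on the same
generator. *)
Fixpoint reduced w : Prop :=
  match w with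
  | [::] => True
  | (b, k) :: w' =>
    [/\ k <> 0%R, reduced w' & forall b' k' w'', w' = (b', k') :: w'' -> b <> b']
  end.

Definition word_value (G : groupType) (i : B -> G) w : G :=
  foldr (fun s x => zpow (i s.1) s.2 * x) 1 w.

Lemma word_value_cons (G : groupType) (i : B -> G) b k w :
  word_value i ((b, k) :: w) = zpow (i b) k * word_value i w.
Proof. by []. Qed.

Lemma multiplicative_word (G H : groupType) (f : {multiplicative G -> H})
    (i : B -> G) (j : B -> H) w :
  (forall b, f (i b) = j b) -> f (word_value i w) = word_value j w.
Proof.
move=> fij; elim: w => [|[b k] w IH]; first exact: multiplicative1.
by rewrite !word_value_cons gmulfM multiplicative_zpow fij IH.
Qed.

Lemma reduced_cat w1 w2 : reduced (w1 ++ w2) -> reduced w2.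
Proof. by elim: w1 => // -[b k] w1 IH /= [_ + _]. Qed.

(** For [u = 1] and [u = -1], where it is applied, the second hypothesis is [zpowS]
or [zpowP]. *)
Lemma reduced_cons_step (G : groupType) (i : B -> G) w b (u : int) :
  u <> 0%R ->
  (forall k, zpow (i b) u * zpow (i b) k = zpow (i b) (u + k)%R) ->
  reduced w ->
  exists2 w', reduced w' & word_value i w' = zpow (i b) u * word_value i w.
Proof.
move=> u0 iu; case: w => [|[b' k] w] wr.
  by exists [:: (b, u)].
have [bb'|bb'] := pselect (b = b'); last first.
  exists [:: (b, u), (b', k) & w] => //.
  by split => // c l w' [<-].
subst b'; case: wr => k0 wr wb.
have [uk|uk] := eqVneq (u + k)%R 0%R.
  by exists w => //; rewrite /= mulgA iu uk mul1g.
exists ((b, (u + k)%R) :: w); last by rewrite /= mulgA iu.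
by split => //; exact/eqP.
Qed.

End reduced_words.

Lemma free_reduced (F : groupType) (B : Type) (i : B -> F) :
  free_on i -> forall x, exists2 w, reduced w & x = word_value i w.
Proof.
move=> Ffree; apply: (free_ind Ffree) => [|b _ [w wr ->]].
  by exists [::].
have [w1 w1r w1E] := reduced_cons_step (b := b) (u := 1%R) (fun e => ltac:(done))
   (fun k => zpowS (i b) k) wr.
have [w2 w2r w2E] := reduced_cons_step (b := b) (u := (- 1)%R)
   (fun e => ltac:(done)) (fun k => zpowP (i b) k) wr.
by split; [exists w1|exists w2].
Qed.

(** ** The Magnus representation of a reduced word *)

Section magnus.
Variables (B : Type) (p : nat) (w : seq (B * int)).
Local Notation m := (size w).
Local Notation K := 'F_p.
Local Notation M := 'M[K]_((size w).+1).
Local Open Scope ring_scope.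

Definition letter (j : nat) : option B := onth (map fst w) j.

(** The sum of the elementary matrices at the superdiagonal positions
[(i, i + 1)] for which the [i]-th syllable of [w] is a power of [b]. *)
Definition letter_mx (b : B) : M :=
  \matrix_(i, j) ((j == i.+1 :> nat) && `[< letter i = Some b >])%:R.

Hypothesis wr : reduced w.

Lemma letter_adjacent i b : letter i = Some b -> letter i.+1 <> Some b.
Proof.
rewrite /letter.
elim: w wr i => [|[c k] l IH] /= wr' [|i] //=.
  case: wr' => _ lr lc [cb]; subst c.
  by case: l lr lc {IH} => // -[c k'] l' lr lc /= [cb]; exact: (lc _ _ _ erefl).
by case: wr' => _ lr _; exact: IH.
Qed.

(** Consecutive syllables are on different generators, so two superdiagonal ones
of [letter_mx b] are never composable.  Hence the powers of [1 + letter_mx b] are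
affine in the exponent. *)
Lemma letter_mx_sq b : letter_mx b * letter_mx b = 0.
Proof.
apply/matrixP => i k; rewrite !mxE big1 // => j _; rewrite !mxE.
have [ji|] := eqVneq (j : nat) i.+1; last by rewrite mul0r.
case: asboolP => [ib|]; last by rewrite mul0r.
case: asboolP => [jb|]; last by rewrite andbF mulr0.
by case: (letter_adjacent ib); rewrite -ji.
Qed.

Lemma unipotent_inverse (N : M) : N * N = 0 -> (1 - N) * (1 + N) = 1.
Proof.
by move=> NN; rewrite mulrDr mulr1 mulrBl mul1r NN subr0 subrK.
Qed.

Lemma letter_unit b : 1 + letter_mx b \is a GRing.unit.
Proof.
apply/unitrP; exists (1 - letter_mx b).
have NN := letter_mx_sq b; split; first exact: unipotent_inverse.
have := @unipotent_inverse (- letter_mx b); rewrite opprK; apply.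
by rewrite mulNr mulrN opprK.
Qed.

Definition magnus_gen (b : B) : {unit M} := FinRing.Unit (letter_unit b).

Lemma magnus_gen_zpow b k :
  val (zpow (magnus_gen b) k) = 1 + letter_mx b *~ k.
Proof.
have NN := letter_mx_sq b.
elim: k => [|n IH|n IH]; first by rewrite mulr0z addr0.
  have -> : n.+1%:Z = 1 + n%:Z by lia.
  rewrite -zpowS FinRing.val_unitM IH /=.
  rewrite mulrDl mul1r mulrDr mulr1 -mulrzr mulrA NN mul0r addr0.
  by rewrite mulrzr mulrzDr mulr1z -addrA [_ + letter_mx b]addrC.
have -> : - n.+1%:Z = - 1 - n%:Z :> int by lia.
rewrite -zpowP FinRing.val_unitM FinRing.val_unitV IH /=.
have -> : (1 + letter_mx b)^-1 = 1 - letter_mx b.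
  by apply: (mulIr (letter_unit b)); rewrite mulVr ?letter_unit// unipotent_inverse.
rewrite mulrDr mulr1 mulrBl mul1r -mulrzr mulrA NN mul0r subr0.
by rewrite mulrzr mulrzDr mulrN1z -addrA.
Qed.

Hypotheses (p_prime : prime p) (p_large : forall b k, List.In (b, k) w -> (`|k| < p)%N).

Lemma coef_neq0 w1 b k w2 : w = w1 ++ (b, k) :: w2 -> k%:~R != 0 :> K.
Proof.
move=> E; rewrite -(dvdz_pcharf (pchar_Fp p_prime)) dvdzE.
have k0 : k <> 0 by have := wr; rewrite E => /reduced_cat[].
apply/negP => /dvdn_leq; rewrite lt0n absz_eq0 => /(_ (introN eqP k0)).
rewrite leqNgt => /negP; apply; apply: (p_large (b := b)).
by rewrite E; apply/List.in_or_app; right; left.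
Qed.

(** Multiplying by one more syllable on the left raises by one position the
highest nonzero entry of the last column, and multiplies it by the exponent of
that syllable.  For the whole word this is the corner entry. *)
Lemma magnus_value_col w1 w2 : w = w1 ++ w2 ->
  let X : M := val (word_value magnus_gen w2) in
  (forall i : 'I_m.+1, (i < size w1)%N -> X i ord_max = 0) /\
  X (inord (size w1)) ord_max != 0.
Proof.
elim: w2 w1 => [|[b k] w2 IH] w1 E X.
  have s1 : size w1 = m by rewrite E cats0.
  split=> [i i1|]; rewrite /X mxE.
    rewrite (_ : (i == ord_max) = false) //; apply/negP => /eqP iE.
    by rewrite iE /= s1 ltnn in i1.
  rewrite (_ : inord _ = ord_max) ?eqxx ?oner_eq0 //.
  by apply: val_inj; rewrite /= inordK ?s1.
have E' : w = rcons w1 (b, k) ++ w2 by rewrite cat_rcons.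
have [] := IH _ E'; set Y : M := val _ => Y0 Y1.
rewrite size_rcons in Y0 Y1.
have s1 : (size w1 < m)%N by rewrite E size_cat /=; lia.
have XE (i : 'I_m.+1) (im : (i < m)%N) : X i ord_max =
    Y i ord_max + `[< letter i = Some b >]%:R * Y (inord i.+1) ord_max *~ k.
  rewrite /X word_value_cons FinRing.val_unitM magnus_gen_zpow -/Y.
  rewrite mulrDl mul1r mxE; congr (_ + _).
  rewrite mulrzAl -scaler_int mxE mulrzl; congr (_ *~ _).
  rewrite mxE (bigD1 (inord i.+1)) //= big1 ?addr0 => [|j ji].
    by rewrite mxE inordK // eqxx.
  rewrite mxE (_ : (j == i.+1 :> nat) = false) ?mul0r //.
  apply: contraNF ji => /eqP ji.
  by apply/eqP/val_inj; rewrite /= inordK.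
have ls : letter (size w1) = Some b.
  by rewrite /letter E map_cat onth_cat size_map ltnn subnn.
split=> [i i1|].
  have im : (i < m)%N by lia.
  rewrite XE // Y0 ?Y0 ?mulr0 ?mul0rz ?addr0 //=; last lia.
  by rewrite inordK //; lia.
rewrite XE ?inordK //; try lia.
rewrite Y0 ?inordK //; last lia.
rewrite ls asboolT // mul1r add0r -mulrzr mulf_neq0 //.
exact: coef_neq0 E.
Qed.

End magnus.

(** Since 3 is invertible modulo [q], [y] is a power of [y ^+ 3 = x ^+ 2]. *)
Lemma commute_of_sq_cube (G : groupType) (x y : G) q :
  coprime 3 q -> y ^+ q = 1 -> x ^+ 2 = y ^+ 3 -> commute x y.
Proof.
move=> co yq xy.
case: (@egcdnP 3 q isT) => u v E _.
have -> : y = (y ^+ 3) ^+ u.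
  rewrite -expgM mulnC E (eqP co) addn1 expgSr mulnC expgM yq.
  by rewrite (_ : 1 ^+ v = 1) ?mul1g //; elim: v {E} => // v IH; rewrite expgS IH mul1g.
by apply: commuteX; rewrite -xy; apply: commuteX.
Qed.

Section unitriangular.
Variables (p n : nat).
Local Notation M := 'M['F_p]_(n.+1).
Local Open Scope ring_scope.

(** For [k = 1] this says that [A] is strictly upper triangular. *)
Definition zero_below (k : nat) (A : M) : Prop :=
  forall i j : 'I_n.+1, (j < i + k)%N -> A i j = 0.

Lemma zero_below_mul k l A A' :
  zero_below k A -> zero_below l A' -> zero_below (k + l) (A * A').
Proof.
move=> Ak Al i j ij; rewrite mxE big1 // => h _.
have [hk|hk] := ltnP h (i + k); first by rewrite Ak // mul0r.
by rewrite Al ?mulr0 //; lia.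
Qed.

Lemma zero_belowD k A A' :
  zero_below k A -> zero_below k A' -> zero_below k (A + A').
Proof. by move=> Ak Ak' i j ij; rewrite mxE Ak // Ak' // addr0. Qed.

Lemma zero_belowW k l A : (l <= k)%N -> zero_below k A -> zero_below l A.
Proof. by move=> lk Ak i j ij; apply: Ak; lia. Qed.

Lemma zero_below_exp A k : zero_below 1 A -> zero_below k (A ^+ k).
Proof.
move=> A1; elim: k => [|k IH].
  by move=> i j ij; rewrite expr0 mxE; case: eqP => // ?; subst; lia.
by rewrite exprS -add1n; exact: zero_below_mul.
Qed.

(** In characteristic [p], [(1 + S) ^+ (p ^ r) = 1 + S ^+ (p ^ r)], and [S] is
nilpotent. *)
Lemma unitriangular_exp_p (A : M) : prime p ->
  zero_below 1 (A - 1) -> exists r, A ^+ (p ^ r)%N = 1.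
Proof.
move=> p_prime; set S := A - 1 => S1; exists n.+1.
have -> : A = 1 + S by rewrite addrC subrK.
have pM : p \in [pchar M] by rewrite (pchar_lalg M); exact: pchar_Fp.
have -> r : (1 + S) ^+ (p ^ r)%N = 1 + S ^+ (p ^ r)%N.
  elim: r => [|r IH]; first by rewrite !expn0 !expr1.
  rewrite expnSr !exprM IH -!(pFrobenius_autE pM) pFrobenius_autD_comm.
    by rewrite pFrobenius_aut1.
  exact: commr_sym (commr1 _).
have /= S0 : zero_below n.+1 (S ^+ (p ^ n.+1)).
  have := zero_below_exp (k := (p ^ n.+1)%N) S1; apply: zero_belowW.
  by apply: ltnW; apply: ltn_expl; apply: prime_gt1.
suff -> : S ^+ (p ^ n.+1)%N = 0 by rewrite addr0.
by apply/matrixP => i j; rewrite mxE S0 //; have := ltn_ord j; lia.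
Qed.

End unitriangular.

Section magnus_map.
Variables (B : Type) (p : nat) (w : seq (B * int)).
Hypotheses (p_prime : prime p) (wr : reduced w).
Hypothesis p_large : forall b k, List.In (b, k) w -> (`|k| < p)%N.
Variables (F : groupType) (i : B -> F) (Ffree : free_on i).

Local Notation U := {unit 'M['F_p]_((size w).+1)}.
Variable f : {multiplicative F -> U}.
Hypothesis fE : forall b, f (i b) = magnus_gen p wr b.

(** The corner entry is nonzero, and it lies off the diagonal. *)
Lemma magnus_map_neq1 : w <> [::] -> f (word_value i w) <> 1.
Proof.
move=> w0; rewrite (multiplicative_word _ fE).
have [_] := magnus_value_col wr p_prime p_large (w1 := [::]) erefl.
move=> + E; rewrite E; rewrite /= mxE.
rewrite (_ : (inord 0 == ord_max) = false) ?eqxx //.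
apply/negP => /eqP /(congr1 (@nat_of_ord _)); rewrite /= inordK // => /esym /size0nil.
by [].
Qed.

(** All values of the representation are unitriangular, because those of the
basis and of its inverses are. *)
Lemma magnus_map_order x : exists r, f x ^+ (p ^ r)%N = 1.
Proof.
suff /(unitriangular_exp_p p_prime)[r fr] :
    zero_below 1 (val (f x) - 1)%R.
  by exists r; apply: val_inj; rewrite FinRing.val_unitX.
have N1 b : zero_below 1 (letter_mx p w b).
  by move=> j k jk; rewrite mxE (_ : (k == j.+1 :> nat) = false) //; lia.
apply: (free_ind Ffree (P := fun x => zero_below 1 (val (f x) - 1)%R)).
  by rewrite multiplicative1 /= subrr => j k _; rewrite mxE.
have step (A X : 'M['F_p]_((size w).+1)) : zero_below 1 A -> zero_below 1 (X - 1)%R ->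
    zero_below 1 ((1 + A) * X - 1)%R.
  move=> A1 X1; have -> : ((1 + A) * X - 1 = (X - 1) + (A + A * (X - 1)))%R.
    by rewrite mulrDl mul1r mulrBr mulr1 [(A + _)%R]addrC subrK addrAC.
  apply: zero_belowD => //; apply: zero_belowD => //.
  exact: zero_belowW (zero_below_mul A1 X1).
move=> b y y1; rewrite !gmulfM multiplicativeV !FinRing.val_unitM fE; split.
  exact: step.
have := magnus_gen_zpow p wr b (-1)%R; rewrite mulrN1z => ->.
by apply: step => // j k jk; rewrite mxE N1 // oppr0.
Qed.

End magnus_map.

(** Otherwise the commutator is a nonempty reduced word.  Its Magnus
representation modulo a prime [p > 3] that exceeds all its exponents is
nontrivial on it, yet makes the images of [x] and [y] commute. *)
Lemma free_sq_cube_commute (F : groupType) (x y : F) :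
  free_group F -> x ^+ 2 = y ^+ 3 -> commute x y.
Proof.
move=> [B [i Ffree]] xy; apply/commgP/eqP; apply: contrapT => c1.
have [w wr cw] := free_reduced Ffree [~ x, y].
have w0 : w <> [::] by move=> w0; rewrite cw w0 in c1.
have [p p_gt p_prime] := prime_above (4 + \sum_(s <- w) `|s.2|)%N.
have p_large b k : List.In (b, k) w -> (`|k| < p)%N.
  move=> bk; apply: leq_ltn_trans p_gt; apply: leq_trans (leq_addl _ _).
  elim: (w) bk => //= s l IH [->|/IH {}IH]; rewrite big_cons; first exact: leq_addr.
  exact: leq_trans IH (leq_addl _ _).
have [f [fE _]] := Ffree _ (magnus_gen p wr).
apply: (magnus_map_neq1 p_prime p_large fE w0); rewrite -cw.
have [r yr] := magnus_map_order p_prime Ffree fE y.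
have /commgP/eqP : commute (f x) (f y).
  apply: commute_of_sq_cube yr _; last by rewrite -!multiplicativeX xy.
  rewrite coprimeXr // prime_coprime // dvdn_prime2 //.
  by apply/eqP => p3; move: p_gt; rewrite -p3.
by move=> <-; rewrite /commg /conjg !gmulfM !multiplicativeV.
Qed.

Lemma residually_free_sq_cube_commute (G : groupType) (x y : G) :
  residually_free G -> x ^+ 2 = y ^+ 3 -> commute x y.
Proof.
move=> Gfree xy; apply/commgP/eqP; apply: contrapT => /Gfree[F [f [Ffree]]]; apply.
have /commgP/eqP : commute (f x) (f y).
  by apply: free_sq_cube_commute => //; rewrite -!multiplicativeX xy.
by move=> <-; rewrite /commg /conjg !gmulfM !multiplicativeV.
Qed.

(** * Homotopy lifting for regular coverings *)

Local Close Scope group_scope.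
Local Open Scope classical_set_scope.
Local Open Scope ring_scope.
Local Open Scope quotient_scope.

Lemma continuous_compose (X Y Z : topologicalType) (f : X -> Y) (g : Y -> Z) :
  continuous f -> continuous g -> continuous (fun x => g (f x)).
Proof. by move=> cf cg x; apply: continuous_comp; [exact: cf|exact: cg]. Qed.

Lemma fst_continuous (X Y : topologicalType) : continuous (@fst X Y).
Proof. by move=> z; exact: cvg_fst. Qed.

Lemma snd_continuous (X Y : topologicalType) : continuous (@snd X Y).
Proof. by move=> z; exact: cvg_snd. Qed.

Lemma id_continuous (X : topologicalType) : continuous (fun x : X => x).
Proof. by move=> x; exact: cvg_id. Qed.

Lemma pairl_continuous (X Y : topologicalType) (y : Y) : continuous (fun x : X => (x, y)).
Proof.
apply: (@continuous_pair X X Y id (fun=> y)); first exact: id_continuous.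
exact: cst_continuous.
Qed.

Lemma pairr_continuous (X Y : topologicalType) (x : X) : continuous (fun y : Y => (x, y)).
Proof.
apply: (@continuous_pair Y X Y (fun=> x) id); first exact: cst_continuous.
exact: id_continuous.
Qed.

Lemma prod_map_continuous (X Y X' Y' : topologicalType) (f : X -> X') (g : Y -> Y') :
  continuous f -> continuous g -> continuous (fun z : X * Y => (f z.1, g z.2)).
Proof.
move=> cf cg.
apply: (@continuous_pair (X * Y)%type X' Y' (fun z => f z.1) (fun z => g z.2)).
  exact: continuous_compose (@fst_continuous _ _) cf.
exact: continuous_compose (@snd_continuous _ _) cg.
Qed.

(** Local sections come from the openness and the local injectivity of [pr].  The
last field makes the deck transformations transitive on the fibres, so that two
lifts can always be matched at a point. *)
Record regular_covering (E B : topologicalType) (pr : E -> B) : Prop := {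
  covering_hausdorff : hausdorff_space E;
  covering_continuous : continuous pr;
  covering_open : forall U, open U -> open (pr @` U);
  covering_surjective : forall b, exists e, pr e = b;
  covering_inj : forall e, exists U : set E,
    [/\ open U, U e & forall x y, U x -> U y -> pr x = pr y -> x = y];
  covering_deck : forall e e', pr e = pr e' -> exists g : E -> E,
    [/\ continuous g, forall x, pr (g x) = pr x & g e = e']
}.

Section covering.
Variables (E B : topologicalType) (pr : E -> B) (cov : regular_covering pr).

(** The set where two lifts agree is open, as [pr] is locally injective, and
closed, as the total space is Hausdorff. *)
Lemma lift_unique (Z : topologicalType) (u v : Z -> E) (z0 : Z) :
  connected [set: Z] -> continuous u -> continuous v ->
  (forall z, pr (u z) = pr (v z)) -> u z0 = v z0 -> forall z, u z = v z.
Proof.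
move=> cZ cu cv uv uv0.
suff : [set z | u z = v z] = setT by move=> e z; have : setT z by []; rewrite -e.
apply: cZ; first by exists z0.
- exists [set z | u z = v z]; last by rewrite setTI.
  rewrite openE => z /= uvz.
  have [U [oU Uz Uinj]] := covering_inj cov (u z).
  have nu : nbhs z (u @^-1` U) by apply: cu; exact: open_nbhs_nbhs.
  have nv : nbhs z (v @^-1` U) by apply: cv; apply: open_nbhs_nbhs; rewrite -uvz.
  by apply: filterS (filterI nu nv) => z' [/= Uu Uv]; exact: Uinj.
- exists [set z | u z = v z]; last by rewrite setTI.
  rewrite -openC openE => z /= /eqP uvz.
  have := covering_hausdorff cov; rewrite open_hausdorff => /(_ _ _ uvz).
  case=> -[U V] /= [/set_mem Uu /set_mem Vv] [oU oV /eqP UV0].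
  have nu : nbhs z (u @^-1` U) by apply: cu; exact: open_nbhs_nbhs.
  have nv : nbhs z (v @^-1` V) by apply: cv; exact: open_nbhs_nbhs.
  apply: filterS (filterI nu nv) => z' [/= Uu' Vv'] uv'.
  have : (U `&` V) (u z') by split => //; rewrite uv'.
  by rewrite UV0.
Qed.

Lemma local_section (b : B) : exists (W : set B) (sec : B -> E),
  [/\ open W, W b, forall c, W c -> pr (sec c) = c &
      forall c, W c -> {for c, continuous sec}].
Proof.
have [e <-] := covering_surjective cov b.
have [U [oU Ue Uinj]] := covering_inj cov e.
have /choice[sec secP] : forall c, exists x, (pr @` U) c -> U x /\ pr x = c.
  move=> c; have [[x Ux xc]|nc] := pselect ((pr @` U) c); first by exists x.
  by exists e => /nc.
exists (pr @` U), sec; split.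
- exact: covering_open.
- by exists e.
- by move=> c /secP[].
- move=> c Wc N /=; rewrite nbhsE => -[V [oV Vc] VN].
  have [Uc cE] := secP _ Wc.
  rewrite nbhs_filterE; change (nbhs c (sec @^-1` N)).
  rewrite nbhsE; exists (pr @` (U `&` V)).
    split; first by apply: (covering_open cov); exact: openI.
    by exists (sec c).
  move=> c' [x [Ux Vx] xc'] /=; apply: VN.
  have [Uc' c'E] := secP c' (ex_intro2 _ _ x Ux xc').
  by rewrite (Uinj (sec c') x) // c'E xc'.
Qed.

Variable R : realType.

(** The retraction of the line onto the segment from [a] to [b]. *)
Definition clip (a b x : R) : R := Num.max a (Num.min b x).

Lemma clip_continuous a b : continuous (clip a b).
Proof.
move=> x; apply: continuous_max; first exact: cst_continuous.
by apply: continuous_min; [exact: cst_continuous|exact: id].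
Qed.

Ltac clip_cases :=
  repeat (match goal with |- context [Order.min ?x ?y] => case: (leP x y) => ? end);
  repeat (match goal with |- context [Order.max ?x ?y] => case: (leP x y) => ? end);
  lra.

Lemma clip_itv a b x : a <= b -> a <= clip a b x <= b.
Proof. by rewrite /clip => ab; clip_cases. Qed.

Lemma clip_id a b x : a <= x <= b -> clip a b x = x.
Proof. by rewrite /clip => ab; clip_cases. Qed.

Lemma clip_le a b c x : a <= b <= c -> x <= b -> clip a c x = clip a b x.
Proof. by rewrite /clip => ab xb; clip_cases. Qed.

Lemma clip_ge a b c x : a <= b <= c -> b <= x -> clip a c x = clip b c x.
Proof. by rewrite /clip => ab xb; clip_cases. Qed.

Lemma clip_at a b c : a <= b <= c -> clip a b b = clip b c b.
Proof. by rewrite /clip => ab; clip_cases. Qed.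

(** A lift over the rectangle from [(a, c)] to [(b, d)], extended to the whole
plane through the retraction of the plane onto the rectangle: all maps involved
are then plainly continuous, and pasting needs no subspace topology. *)
Definition liftable (H : R * R -> B) (a b c d : R) :=
  exists2 L : R * R -> E, continuous L &
    forall z, pr (L z) = H (clip a b z.1, clip c d z.2).

Lemma liftable_swap H a b c d : liftable H a b c d ->
  liftable (fun z => H (z.2, z.1)) c d a b.
Proof.
case=> L cL LH; exists (fun z => L (z.2, z.1)) => //.
exact: continuous_compose (@swap_continuous R R) cL.
Qed.

Lemma real_connected : connected [set: R].
Proof. by apply/connected_intervalP => x y _ _ z _. Qed.

(** A deck transformation matches the two lifts at one point of the line [z.1 = b];
by uniqueness they then agree along this line. *)
Lemma liftable_glue H a b b' c d : continuous H -> a <= b <= b' ->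
  liftable H a b c d -> liftable H b b' c d -> liftable H a b' c d.
Proof.
move=> cH ab [L cL LH] [L' cL' LH'].
have [|g [cg prg gE]] := @covering_deck _ _ _ cov (L' (b, 0)) (L (b, 0)).
  by rewrite LH LH' /= -(clip_at ab).
have cgL' : continuous (g \o L') by exact: continuous_compose cL' cg.
exists (fun z => if z.1 <= b then L z else g (L' z)).
  apply: (@pasting R (R * R)%type E fst b L (g \o L')) => //.
    exact: fst_continuous.
  move=> [z1 z2] /= ->.
  have cb : continuous (fun y : R => (b, y)) by exact: pairr_continuous.
  apply: (@lift_unique R (fun y => L (b, y)) (fun y => g (L' (b, y))) 0) => //.
  - exact: real_connected.
  - exact: continuous_compose cb cL.
  - exact: continuous_compose cb cgL'.
  - by move=> y; rewrite prg LH LH' /= (clip_at ab).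
move=> z; case: (leP z.1 b) => zb; first by rewrite LH (clip_le ab).
by rewrite prg LH' (clip_ge ab) // ltW.
Qed.

Lemma liftable_small H (z : R * R) : continuous H ->
  \forall z' \near z & N \near \oo,
    liftable H z'.1 (z'.1 + N.+1%:R^-1) z'.2 (z'.2 + N.+1%:R^-1).
Proof.
move=> cH; have [W [sec [oW Wz secE secC]]] := local_section (H z).
have /nbhs_ballP[e /= e0 eW] : nbhs z (H @^-1` W) by apply: cH; exact: open_nbhs_nbhs.
exists (ball z (e / 2), [set N | N.+1%:R^-1 < e / 2]).
  split => /=; first by apply: nbhsx_ballx; rewrite divr_gt0.
  by apply: near_infty_natSinv_lt (PosNum _); rewrite divr_gt0.
move=> [z' N] /= [[z1 z2] Ne]; set d := N.+1%:R^-1 in Ne *.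
have d0 : 0 < d by rewrite invr_gt0 ltr0n.
have inW y : W (H (clip z'.1 (z'.1 + d) y.1, clip z'.2 (z'.2 + d) y.2)).
  apply: eW; have c1 := @clip_itv z'.1 (z'.1 + d) y.1.
  have c2 := @clip_itv z'.2 (z'.2 + d) y.2.
  have {z1} : `|z.1 - z'.1| < e / 2 by exact: z1.
  have {z2} : `|z.2 - z'.2| < e / 2 by exact: z2.
  rewrite !ltr_norml => z2 z1.
  split; rewrite /ball /= ltr_norml; lra.
exists (fun y => sec (H (clip z'.1 (z'.1 + d) y.1, clip z'.2 (z'.2 + d) y.2))).
  move=> y; apply: (@continuous_comp _ _ _ (fun y : R * R =>
     H (clip z'.1 (z'.1 + d) y.1, clip z'.2 (z'.2 + d) y.2)) sec); last exact: secC.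
  apply: (continuous_compose (prod_map_continuous _ _) cH); exact: clip_continuous.
by move=> y; exact: secE.
Qed.

(** By compactness all cells of a fine enough grid are liftable; they are glued
into strips, and the strips into the square. *)
Lemma liftable_square H : continuous H -> liftable H 0 1 0 1.
Proof.
move=> cH.
have /compact_near_coveringP cK : compact (`[0 : R, 1]%classic `*` `[0 : R, 1]%classic).
  by apply: compact_setX; exact: segment_compact.
have := cK _ \oo
  (fun N z' => liftable H z'.1 (z'.1 + N.+1%:R^-1) z'.2 (z'.2 + N.+1%:R^-1))
  _ (fun z _ => liftable_small z cH).
case=> N _ /(_ N (leqnn N)) small.
set d := N.+1%:R^-1 in small.
have d0 : 0 < d by rewrite invr_gt0 ltr0n.
have dN : N.+1%:R * d = 1 by rewrite mulfV // pnatr_eq0.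
have kd k : (k < N.+1)%N -> 0 <= k%:R * d /\ k.+1%:R * d <= 1.
  move=> kN; split; first by rewrite mulr_ge0 // ltW.
  by rewrite -[leRHS]dN ler_pM2r // ler_nat.
have {small} cell a b : 0 <= a <= 1 -> 0 <= b <= 1 -> liftable H a (a + d) b (b + d).
  by move=> a01 b01; apply: (small (a, b)); split; rewrite /= in_itv.
have strip j : (j < N.+1)%N -> forall k, (k <= N)%N ->
    liftable H 0 (k.+1%:R * d) (j%:R * d) (j.+1%:R * d).
  move=> jN; have [j0 j1] := kd _ jN.
  have jE : j.+1%:R * d = j%:R * d + d by rewrite -natr1 mulrDl mul1r.
  elim=> [_|k IH kN].
    by rewrite jE mul1r; have := cell 0 (j%:R * d); rewrite add0r; apply; lra.
  have [k0 k1] := kd _ (ltnW (kN : (k.+1 < N.+1)%N)).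
  have [_ k2] := kd _ (kN : (k.+1 < N.+1)%N).
  have kE : k.+2%:R * d = k.+1%:R * d + d by rewrite -natr1 mulrDl mul1r.
  apply: liftable_glue (IH (ltnW kN)) _ => //; first by lra.
  by rewrite jE kE; apply: cell; lra.
have full j : (j <= N)%N -> liftable H 0 1 0 (j.+1%:R * d).
  elim: j => [_|j IH jN].
    by have := strip 0 (ltn0Sn _) N (leqnn N); rewrite dN mul0r.
  have [j0 j1] := kd _ (jN : (j.+1 < N.+1)%N).
  have jE : j.+2%:R * d = j.+1%:R * d + d by rewrite -natr1 mulrDl mul1r.
  have /liftable_swap L1 := IH (ltnW jN).
  have := strip _ (jN : (j.+1 < N.+1)%N) N (leqnn N); rewrite dN => /liftable_swap L2.
  have := liftable_glue _ _ L1 L2 => L3.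
  apply: (@liftable_swap (fun z => H (z.2, z.1))); apply: L3; last by lra.
  exact: continuous_compose (@swap_continuous R R) cH.
by have := full N (leqnn N); rewrite dN.
Qed.

Local Notation I := (unit_interval R).

Definition lifts_path (x y : B) (e f : E) (p : {path I from x to y})
    (q : {path I from e to f}) := forall s, pr (q s) = p s.

Lemma itv_connected : connected [set: I].
Proof.
suff -> : [set: I] = @clamp R @` [set: R].
  apply: connected_continuous_connected real_connected _.
  by apply: continuous_subspaceT => t; exact: clamp_continuous.
by apply/seteqP; split => // s _; exists (val s) => //; rewrite clampK.
Qed.

(** Lift the homotopy.  Its two vertical sides are constant paths, hence so are
their lifts, while the horizontal sides lift to the given paths. *)
Lemma monodromy x y (p p' : {path I from x to y}) e f f'
    (q : {path I from e to f}) (q' : {path I from e to f'}) :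
  homotopic p p' -> lifts_path p q -> lifts_path p' q' -> f = f'.
Proof.
move=> [H [cH H0 H1 Hx]] pq pq'.
have [|L cL LH] := @liftable_square (fun z => H (clamp z.1, clamp z.2)).
  apply: (continuous_compose (prod_map_continuous _ _) cH); exact: clamp_continuous.
have [|g [cg prg gE]] := @covering_deck _ _ _ cov (L (0, 0)) e.
  rewrite LH /= !clip_id ?lexx ?ler01 // clamp0 (Hx _).1.
  by rewrite -(path_zero (s := q)) pq path_zero.
pose M (s t : I) := g (L (val s, val t)).
have prM s t : pr (M s t) = H (s, t).
  by rewrite /M prg LH /= !clip_id ?itv_ge0 ?itv_le1 // !clampK.
have cM : continuous (fun z : I * I => M z.1 z.2).
  apply: (continuous_compose _ (continuous_compose cL cg)).
  exact: prod_map_continuous (@val_itv_continuous R) (@val_itv_continuous R).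
have cMl t : continuous (fun s => M s t).
  exact: continuous_compose (@pairl_continuous _ _ t) cM.
have cMr s : continuous (fun t => M s t).
  exact: continuous_compose (@pairr_continuous _ _ s) cM.
have M00 : M zero zero = e by rewrite /M !val_zero.
have M0 t : M zero t = e.
  apply: (@lift_unique I (M zero) (cst e) zero itv_connected (cMr _)) => //.
    exact: cst_continuous.
  by move=> {}t; rewrite prM (Hx _).1 /= -(path_zero (s := q)) pq path_zero.
have Mq s : M s zero = q s.
  apply: (@lift_unique I (M^~ zero) q zero itv_connected (cMl _)) => //.
  - exact: path_continuous.
  - by move=> {}s; rewrite prM H0 pq.
  - by rewrite M0 path_zero.
have Mq' s : M s one = q' s.
  apply: (@lift_unique I (M^~ one) q' zero itv_connected (cMl _)) => //.
  - exact: path_continuous.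
  - by move=> {}s; rewrite prM H1 pq'.
  - by rewrite M0 path_zero.
have M1 t : M one t = M one zero.
  apply: (@lift_unique I (M one) (cst (M one zero)) zero itv_connected (cMr _)) => //.
    exact: cst_continuous.
  by move=> {}t; rewrite /= !prM !(Hx _).2.
by rewrite -(path_one (s := q)) -Mq -(M1 one) Mq' path_one.
Qed.

End covering.

(** * Configurations cover their orbits *)

Section configurations.
Variables (S : topologicalType) (n : nat).
Local Notation conf := (configuration_space S n).
Local Notation pr := (\pi_(orbit_space S n) : conf -> orbit_space S n).

Definition point_at (x : conf) (i : 'I_n) : S := val x i.

Lemma point_at_ext (x y : conf) : (forall i, point_at x i = point_at y i) -> x = y.
Proof. by move=> xy; apply: val_inj; apply/funext. Qed.

Lemma point_at_neq (x : conf) i j : i <> j -> point_at x i <> point_at x j.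
Proof. by case: x => x /= xP; rewrite /point_at /=; move/set_mem: xP; apply. Qed.

Lemma point_at_continuous i : continuous (point_at^~ i).
Proof.
apply: (@continuous_compose _ _ _ (val : conf -> {ptws 'I_n -> S}) (fun f => f i)).
  exact: initial_continuous.
exact: (@proj_continuous 'I_n (fun=> S) i).
Qed.

Lemma configuration_continuous (Z : topologicalType) (f : Z -> conf) :
  (forall i, continuous (fun z => point_at (f z) i)) -> continuous f.
Proof.
move=> cf; apply: continuous_comp_initial => z; apply/cvg_sup => i.
apply/cvg_image; first by apply/seteqP; split => // y _; exists (fun=> y).
move=> U /(cf i z) nU; exists ((fun g : 'I_n -> S => g i) @^-1` U) => //.
rewrite image_preimage //; apply/seteqP; split => // y _; exists (fun=> y) => //.
Qed.

Lemma configurationP (f : 'I_n -> S) : (forall i j, i <> j -> f i <> f j) ->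
  f \in @distinct_points S n.
Proof. by move=> fP; rewrite inE. Qed.

Definition configuration (f : 'I_n -> S) (fP : forall i j, i <> j -> f i <> f j) : conf :=
  exist (fun x => x \in _) (f : {ptws 'I_n -> S}) (configurationP fP).

Lemma relabel_subproof (s : 'S_n) (x : conf) i j : i <> j ->
  point_at x (s i) <> point_at x (s j).
Proof. by move=> ij; apply: point_at_neq => /perm_inj. Qed.

Definition relabel (s : 'S_n) (x : conf) : conf := configuration (@relabel_subproof s x).

Lemma point_at_relabel s x i : point_at (relabel s x) i = point_at x (s i).
Proof. by []. Qed.

Lemma relabel_continuous s : continuous (relabel s).
Proof. by apply: configuration_continuous => i; exact: point_at_continuous. Qed.

Lemma relabelM s t x : relabel s (relabel t x) = relabel (s * t)%g x.
Proof. by apply: point_at_ext => i; rewrite !point_at_relabel permM. Qed.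

Lemma relabel_inj x : injective (relabel^~ x).
Proof.
move=> s t /= st; apply/permP => i; apply: contrapT => /(@point_at_neq x).
by rewrite -!point_at_relabel st.
Qed.

Lemma orbitP x y : pr x = pr y <-> exists s, y = relabel s x.
Proof.
split=> [/eqmodP/asboolP[s xy]|[s ->]]; first by exists s; apply: point_at_ext.
by apply/eqmodP/asboolP; exists s.
Qed.

Lemma orbit_relabel s x : pr (relabel s x) = pr x.
Proof. by apply/esym/orbitP; exists s. Qed.

(** The neighbourhood on which the projection is injective is a box of pairwise
disjoint neighbourhoods of the points of [e]: a permutation other than the
identity moves some point of the configuration to another factor. *)
Lemma configuration_covering : hausdorff_space S -> regular_covering pr.
Proof.
move=> hS; split.
- rewrite open_hausdorff => x y xy.
  have /existsNP[i /eqP] : ~ forall i, point_at x i = point_at y i.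
    by move=> e; move/eqP: xy; apply; exact: point_at_ext.
  have := hS; rewrite open_hausdorff => /[apply].
  case=> -[U V] /= [/set_mem Ux /set_mem Vy] [oU oV /eqP UV0].
  exists ((point_at^~ i) @^-1` U, (point_at^~ i) @^-1` V); first by split; exact/mem_set.
  have cp := @point_at_continuous i; move/continuousP in cp.
  by split; [exact: cp|exact: cp|rewrite -preimage_setI UV0 preimage_set0].
- exact: pi_continuous.
- move=> U oU; change (open (pr @^-1` (pr @` U))).
  have -> : pr @^-1` (pr @` U) = \bigcup_(s in [set: 'S_n]) relabel s @^-1` U.
    apply/seteqP; split => [x [y Uy /esym/orbitP[s yE]]|x [s _ Us]].
      by exists s => //=; rewrite -yE.
    by exists (relabel s x) => //; rewrite orbit_relabel.
  apply: bigcup_open => s _.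
  by move/continuousP: (@relabel_continuous s); apply.
- by move=> b; exists (repr b); rewrite reprK.
- move=> e; have sep i j : exists UV : set S * set S, i != j ->
      [/\ open UV.1, open UV.2, UV.1 (point_at e i), UV.2 (point_at e j) &
          UV.1 `&` UV.2 = set0].
    have [->|ij] := eqVneq i j; first by exists (set0, set0).
    have /eqP := @point_at_neq e i j (elimN eqP ij).
    have := hS; rewrite open_hausdorff => /[apply].
  case=> -[U V] /= [/set_mem Ux /set_mem Vy] [oU oV /eqP UV0].
    by exists (U, V).
  have /choice[W WP] : forall i, exists W : 'I_n -> set S * set S, forall j, i != j ->
      [/\ open (W j).1, open (W j).2, (W j).1 (point_at e i), (W j).2 (point_at e j) &
          (W j).1 `&` (W j).2 = set0].
    by move=> i; have [W WP] := choice (sep i); exists W.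
  pose D i j := if i == j then setT else (W i j).1 `&` (W j i).2.
  have DP i j : open (D i j) /\ D i j (point_at e i).
    rewrite /D; case: eqVneq => [_|ij]; first by split => //; exact: openT.
    have [? _ ? _ _] := WP _ _ ij; rewrite eq_sym in ij; have [_ ? _ ? _] := WP _ _ ij.
    by split; [exact: openI|].
  exists [set x | forall i j, D i j (point_at x i)]; split.
  + rewrite openE => x /= Dx.
    apply: (@filter_forall conf 'I_n
      (fun i y => forall j, D i j (point_at y i)) (nbhs x)) => i.
    apply: (@filter_forall conf 'I_n (fun j y => D i j (point_at y i)) (nbhs x)) => j.
    by apply: (@point_at_continuous i x); apply: open_nbhs_nbhs; split; [exact: (DP i j).1|].
  + by move=> i j; exact: (DP i j).2.
  + move=> x y Dx Dy /orbitP[s yE]; suff : s = 1%g.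
      by move=> s1; apply: point_at_ext => i; rewrite yE s1 point_at_relabel perm1.
    apply/permP => i; rewrite perm1; apply: contrapT => /eqP si.
    have [_ _ _ _] := WP _ _ si.
    move/seteqP => [/(_ (point_at x (s i))) + _]; apply; split.
      by have := Dx (s i) i; rewrite /D (negbTE si) => -[].
    have := Dy i (s i); rewrite /D eq_sym (negbTE si) => -[_].
    by rewrite yE point_at_relabel.
- move=> e e' /orbitP[s ->]; exists (relabel s); split => //.
    exact: relabel_continuous.
  by move=> x; exact: orbit_relabel.
Qed.

End configurations.

(** * Loops, changes of base point and monodromy *)

Section base_change.
Variables (R : realType) (X : topologicalType) (x y : X).
Local Notation I := (unit_interval R).
Variable c : {path I from x to y}.

Definition conjugate_loop (p : {path I from y to y}) : {path I from x to x} :=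
  concat (concat c p) (reverse c).

Definition base_change (a : fundamental_group R y) : fundamental_group R x :=
  \pi_(fundamental_group R x) (conjugate_loop (repr a)).

Lemma base_changeE p : base_change (\pi_(fundamental_group R y) p) =
  \pi_(fundamental_group R x) (conjugate_loop p).
Proof.
apply/loop_class_eqP/homotopic_concat; last exact: homotopic_refl.
by apply: homotopic_concat; [exact: homotopic_refl|exact: homotopic_repr].
Qed.

Lemma conjugate_loop_concat p q :
  homotopic (concat (conjugate_loop p) (conjugate_loop q)) (conjugate_loop (concat p q)).
Proof.
have hr := @homotopic_refl R X.
have cancel : homotopic (concat (reverse c) (conjugate_loop q)) (concat q (reverse c)).
  apply: homotopic_trans (homotopic_concatA _ _ _) _.
  apply: homotopic_concat => //.
  apply: homotopic_trans (homotopic_concatA _ _ _) _.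
  apply: homotopic_trans (homotopic_const_concat _).
  by apply: homotopic_concat => //; exact: homotopic_reverse_concat.
apply: homotopic_trans (homotopic_sym (homotopic_concatA _ _ _)) _.
apply: homotopic_trans (homotopic_concat (hr _ _ _) cancel) _.
apply: homotopic_trans (homotopic_concatA _ _ _) _.
by apply: homotopic_concat => //; apply: homotopic_sym; exact: homotopic_concatA.
Qed.

Lemma base_changeM a b : base_change (a * b)%g = (base_change a * base_change b)%g.
Proof.
elim/quotW: a => p; elim/quotW: b => q.
transitivity (base_change (\pi_(fundamental_group R y) (concat p q))).
  by congr base_change; exact: pi1_mulE.
rewrite !base_changeE; transitivity (\pi_(fundamental_group R x)
   (concat (conjugate_loop p) (conjugate_loop q))).
  by apply/esym/loop_class_eqP; exact: conjugate_loop_concat.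
by apply/esym; exact: pi1_mulE.
Qed.

HB.instance Definition _ := isMultiplicative.Build _ _ base_change base_changeM.

End base_change.

Section lifts_path.
Variables (R : realType) (E B : topologicalType) (f : E -> B).
Local Notation I := (unit_interval R).

Lemma lifts_concat x y z e e' e'' (p : {path I from x to y}) (q : {path I from y to z})
    (p' : {path I from e to e'}) (q' : {path I from e' to e''}) :
  lifts_path f p p' -> lifts_path f q q' -> lifts_path f (concat p q) (concat p' q').
Proof. by move=> pp' qq' s; rewrite !concatE; case: ifP. Qed.

Lemma lifts_reverse x y e e' (p : {path I from x to y}) (p' : {path I from e to e'}) :
  lifts_path f p p' -> lifts_path f (reverse p) (reverse p').
Proof. by move=> pp' s; rewrite !reverseE. Qed.

Lemma lifts_compose x y e e' (g : E -> E) (cg : continuous g) (p : {path I from x to y})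
    (p' : {path I from e to e'}) :
  (forall z, f (g z) = f z) -> lifts_path f p p' ->
  exists q : {path I from g e to g e'}, lifts_path f p q.
Proof.
move=> fg pp'.
have q0 : g (p' zero) = g e by rewrite path_zero.
have q1 : g (p' one) = g e' by rewrite path_one.
exists (mk_path (continuous_compose (path_continuous (p := p')) cg) q0 q1) => s.
by rewrite /mk_path fg pp'.
Qed.

End lifts_path.

Section plane_homotopy.
Variables (R : realType) (X : topologicalType) (H : R * R -> X) (cH : continuous H).
Local Notation I := (unit_interval R).

(** The plane is convex: interpolate linearly between the two lifts. *)
Lemma homotopic_plane x y (u v : R * R) (p p' : {path I from x to y})
    (q q' : {path I from u to v}) :
  lifts_path H p q -> lifts_path H p' q' -> homotopic p p'.
Proof.
move=> pq pq'.
exists (fun e => H ((q e.1).1 + val e.2 * ((q' e.1).1 - (q e.1).1),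
                    (q e.1).2 + val e.2 * ((q' e.1).2 - (q e.1).2))); split.
- have cq1 : continuous (fun e : I * I => q e.1).
    exact: continuous_compose (@fst_continuous _ _) (@path_continuous _ _ _ _ q).
  have cq1' : continuous (fun e : I * I => q' e.1).
    exact: continuous_compose (@fst_continuous _ _) (@path_continuous _ _ _ _ q').
  have interp (k : R * R -> R) : continuous k ->
      continuous (fun e : I * I => k (q e.1) + val e.2 * (k (q' e.1) - k (q e.1))).
    move=> ck e.
    have c1 := continuous_compose cq1 ck; have c2 := continuous_compose cq1' ck.
    apply: cvgD; first exact: c1.
    by apply: cvgM; [exact: itv_snd_continuous|apply: cvgB; [exact: c2|exact: c1]].
  apply: (continuous_compose _ cH).
  exact: continuous_pair (interp fst (@fst_continuous _ _)) (interp snd (@snd_continuous _ _)).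
- by move=> s; rewrite val_zero !mul0r !addr0 -pq; case: (q s).
- by move=> s; rewrite val_one !mul1r ![_ + (_ - _)]addrC !subrK -pq'; case: (q' s).
- move=> t; rewrite !path_zero !path_one !subrr !mulr0 !addr0; split.
    by rewrite -(path_zero (s := p)) -pq path_zero; case: (u).
  by rewrite -(path_one (s := p)) -pq path_one; case: (v).
Qed.

Lemma lifts_segment x y (u v : R * R) (p : {path I from x to y}) :
  (forall s, p s = H (u.1 + val s * (v.1 - u.1), u.2 + val s * (v.2 - u.2))) ->
  exists q : {path I from u to v}, lifts_path H p q.
Proof.
move=> pE.
pose q (s : I) := (u.1 + val s * (v.1 - u.1), u.2 + val s * (v.2 - u.2)).
have cq : continuous q.
  apply: (@continuous_pair I R R (fun s => u.1 + val s * (v.1 - u.1))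
    (fun s => u.2 + val s * (v.2 - u.2))).
    by have := @shift_continuous R (v.1 - u.1) u.1; under eq_fun do rewrite addrC mulrC.
  by have := @shift_continuous R (v.2 - u.2) u.2; under eq_fun do rewrite addrC mulrC.
have q0 : q zero = u by rewrite /q val_zero !mul0r !addr0; case: (u).
have q1 : q one = v by rewrite /q val_one !mul1r ![_ + (_ - _)]addrC !subrK; case: (v).
by exists (mk_path cq q0 q1) => s; rewrite pE.
Qed.

Variables (x y : X) (a b : R).
Variables (p : {path I from x to x}) (q : {path I from y to y}) (w : {path I from x to y}).
Hypothesis ab : a + a = b + b + b.
Hypothesis pE : forall s, p s = H (a * val s, 0).
Hypothesis qE : forall s, q s = H (b * val s, 1).
Hypothesis wE : forall s, w s = H (0, val s).
Hypothesis Ha : forall s, H (s + a, 0) = H (s, 0).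
Hypothesis Hb : forall s, H (s + b, 1) = H (s, 1).
Hypothesis Haa : forall t, H (a + a, t) = H (0, t).

(** The paths [p p] and [w (q q q) w^-1] both lift along [H] to paths of the plane
from [(0, 0)] to [(a + a, 0)]; the second one lifts to the other three sides of
a rectangle.  The periods of [H] allow each factor to be lifted from the point
where the previous lift stops. *)
Lemma half_turn_third_turn :
  ((\pi_(fundamental_group R x) p) ^+ 2 =
    base_change w (\pi_(fundamental_group R y) q) ^+ 3)%g.
Proof.
rewrite -multiplicativeX !expgS !expg0 !mulg1.
transitivity (\pi_(fundamental_group R x) (concat p p)); first exact: pi1_mulE.
transitivity (base_change w (\pi_(fundamental_group R y) (concat q (concat q q)))); last first.
  congr base_change; transitivity (\pi_(fundamental_group R y) q *
    \pi_(fundamental_group R y) (concat q q))%g; last by congr (_ * _)%g; exact/esym/pi1_mulE.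
  exact/esym/pi1_mulE.
rewrite base_changeE; apply/loop_class_eqP.
have [|p1 p1P] := @lifts_segment _ _ (0, 0) (a, 0) p.
  by move=> s; rewrite pE /=; congr (H (_, _)); ring.
have [|p2 p2P] := @lifts_segment _ _ (a, 0) (a + a, 0) p.
  by move=> s; rewrite pE -Ha /=; congr (H (_, _)); ring.
have [|q1 q1P] := @lifts_segment _ _ (0, 1) (b, 1) q.
  by move=> s; rewrite qE /=; congr (H (_, _)); ring.
have [|q2 q2P] := @lifts_segment _ _ (b, 1) (b + b, 1) q.
  by move=> s; rewrite qE -Hb /=; congr (H (_, _)); ring.
have [|q3 q3P] := @lifts_segment _ _ (b + b, 1) (a + a, 1) q.
  by move=> s; rewrite qE -Hb -Hb /= ab; congr (H (_, _)); ring.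
have [|w1 w1P] := @lifts_segment _ _ (0, 0) (0, 1) w.
  by move=> s; rewrite wE /=; congr (H (_, _)); ring.
have [|w2 w2P] := @lifts_segment _ _ (a + a, 0) (a + a, 1) w.
  by move=> s; rewrite wE -Haa /=; congr (H (_, _)); ring.
apply: (homotopic_plane (lifts_concat p1P p2P)).
exact: lifts_concat (lifts_concat w1P (lifts_concat q1P (lifts_concat q2P q3P)))
  (lifts_reverse w2P).
Qed.

End plane_homotopy.

Section monodromy.
Variables (R : realType) (S : topologicalType) (n : nat).
Local Notation I := (unit_interval R).
Local Notation conf := (configuration_space S n).
Local Notation pr := (\pi_(orbit_space S n) : conf -> orbit_space S n).

(** A lift of the loop starting at [e] ends at [e] relabelled by [s]. *)
Definition permutes (x : orbit_space S n) (e : conf) (a : fundamental_group R x) (s : 'S_n) :=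
  exists (p : {path I from x to x}) (q : {path I from e to relabel s e}),
    \pi_(fundamental_group R x) p = a /\ lifts_path pr p q.

Lemma permutes_mul x e (a b : fundamental_group R x) s t :
  permutes e a s -> permutes e b t -> permutes e (a * b)%g (s * t)%g.
Proof.
move=> [p [p' [<- pp']]] [q [q' [<- qq']]].
rewrite /permutes -relabelM; exists (concat p q).
have [q'' qq''] := lifts_compose (@relabel_continuous S n s) (@orbit_relabel S n s) qq'.
exists (concat p' q''); split; first exact/esym/pi1_mulE.
exact: lifts_concat.
Qed.

Lemma permutes_unique x e (a : fundamental_group R x) s t :
  hausdorff_space S -> permutes e a s -> permutes e a t -> s = t.
Proof.
move=> hS [p [p' [pa pp']]] [q [q' [qa qq']]]; apply: (@relabel_inj _ _ e).
have pq : homotopic p q by apply/loop_class_eqP; rewrite pa.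
exact: (monodromy (configuration_covering n hS) pq pp' qq').
Qed.

Lemma permutes_base_change x y e f (c : {path I from x to y}) (c' : {path I from e to f})
    (a : fundamental_group R y) s :
  lifts_path pr c c' -> permutes f a s -> permutes e (base_change c a) s.
Proof.
move=> cc' [p [p' [<- pp']]]; exists (conjugate_loop c p).
have [c'' cc''] := lifts_compose (@relabel_continuous S n s) (@orbit_relabel S n s) cc'.
exists (concat (concat c' p') (reverse c'')); split; first by rewrite base_changeE.
exact: lifts_concat (lifts_concat cc' pp') (lifts_reverse cc'').
Qed.

End monodromy.

(** * Moving points on a surface *)

Lemma within_open_continuous (T U : topologicalType) (A : set T) (f : T -> U) :
  open A -> {within A, continuous f} -> forall x, A x -> {for x, continuous f}.
Proof.
move=> oA; rewrite continuous_open_subspace // => cf x /mem_set.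
exact: cf.
Qed.

Section reachability.
Variables (R : realType) (S : topologicalType) (P : set S).
Local Notation I := (unit_interval R).

Definition reachable (x y : S) := exists p : {path I from x to y}, forall s, ~ P (p s).

Lemma reachable_trans y x z : reachable x y -> reachable y z -> reachable x z.
Proof.
by move=> [p pP] [q qP]; exists (concat p q) => s; rewrite concatE; case: ifP.
Qed.

Lemma reachable_refl x : ~ P x -> reachable x x.
Proof. by move=> xP; exists (constant_path R x). Qed.

End reachability.

Section surface_paths.
Variables (R : realType) (S : topologicalType) (S_surface : surface R S).
Local Notation I := (unit_interval R).

Definition box : set (R * R) := [set y | `|y.1| < 1 /\ `|y.2| < 1].

(** A chart inverted near [z], translated and rescaled to the unit box.  Only this
open box is constrained: [g] is arbitrary elsewhere. *)
Record parametrized_box (z : S) (N : set S) (g : R * R -> S) : Prop := {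
  box_center : g (0, 0) = z;
  box_continuous : forall y, box y -> {for y, continuous g};
  box_inside : forall y, box y -> N (g y);
  box_inj : forall y y', box y -> box y' -> g y = g y' -> y = y';
  box_nbhs : nbhs z (g @` box)
}.

Lemma parametrized_box_exists z N : nbhs z N -> exists g, parametrized_box z N g.
Proof.
move=> nN; have [c cz] := surface_charts S_surface z.
pose f := to_plane c; pose h := from_plane c; pose V := f @` chart_dom c.
have oV : open V := @chart_im_open _ _ c.
have hc v : V v -> {for v, continuous h}.
  exact: within_open_continuous oV (@from_plane_continuous _ _ c) v.
have fc : {for z, continuous f}.
  exact: within_open_continuous (@chart_dom_open _ _ c) (@to_plane_continuous _ _ c) z cz.
have fK v : V v -> f (h v) = v by case=> x cx <-; rewrite /h to_planeK.
have Vz : V (f z) by exists z.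
have hz : h (f z) = z by exact: to_planeK.
have : nbhs (f z) (V `&` h @^-1` N).
  apply: filterI; first exact: open_nbhs_nbhs.
  by apply: (hc _ Vz); rewrite hz.
move=> /nbhs_ballP[e /= e0 eVN].
pose k (y : R * R) : R * R := ((f z).1 + e * y.1, (f z).2 + e * y.2).
have kV y : box y -> (V `&` h @^-1` N) (k y).
  case=> y1 y2; apply: eVN; split; rewrite /ball /= opprD addrA subrr sub0r normrN normrM
    (gtr0_norm e0) gtr_pMr //.
have ck : continuous k.
  have kc (u : R) : continuous (fun t : R => u + e * t).
    by move=> t; apply: cvgD; [exact: cvg_cst|apply: cvgM; [exact: cvg_cst|exact: cvg_id]].
  exact: prod_map_continuous (kc _) (kc _).
exists (fun y => h (k y)); split.
- by rewrite /k /= !mulr0 !addr0 -[RHS]hz; congr h; case: (f z).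
- move=> y yb; apply: (@continuous_comp _ _ _ k h); first exact: ck.
  by apply: hc; have [] := kV _ yb.
- by move=> y /kV[].
- move=> [y1 y2] [y1' y2'] /kV[Vy _] /kV[Vy' _] /(congr1 f); rewrite !fK // => -[].
  by move=> /addrI/(mulfI (lt0r_neq0 e0)) -> /addrI/(mulfI (lt0r_neq0 e0)) ->.
- have nb : nbhs z (f @^-1` ball (f z) e) by apply: fc; exact: nbhsx_ballx.
  have nd : nbhs z (chart_dom c) by apply: open_nbhs_nbhs; split; [exact: (@chart_dom_open _ _ c)|].
  apply: filterS (filterI nb nd) => x [/= fx cx].
  exists ((f x - f z).1 / e, (f x - f z).2 / e).
    move: fx => [fx1 fx2]; rewrite /box /= !normrM normfV (gtr0_norm e0).
    rewrite !ltr_pdivrMr // !mul1r [`|_ - _|]distrC [X in _ /\ X < _]distrC.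
    by split; [exact: fx1|exact: fx2].
  rewrite -[RHS](to_planeK cx); congr h; rewrite /k /=.
  have ne0 := lt0r_neq0 e0.
  rewrite ![e * _]mulrC !divfK // ![_ + (_ - _)]addrC !subrK.
  by rewrite /f; case: (to_plane c x).
Qed.

Lemma box_convex a b s : box a -> box b -> 0 <= s <= 1 ->
  box (a.1 + s * (b.1 - a.1), a.2 + s * (b.2 - a.2)).
Proof.
move=> [a1 a2] [b1 b2] /andP[s0 s1].
have conv (u v : R) : `|u| < 1 -> `|v| < 1 -> `|u + s * (v - u)| < 1.
  rewrite !ltr_norml => /andP[u1 u2] /andP[v1 v2].
  have [uv|vu] := leP u v.
    have h1 : 0 <= s * (v - u) by rewrite mulr_ge0 // subr_ge0.
    have h2 : 0 <= (1 - s) * (v - u) by rewrite mulr_ge0 // subr_ge0.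
    lra.
  have h1 : 0 <= s * (u - v) by rewrite mulr_ge0 // subr_ge0 ltW.
  have h2 : 0 <= (1 - s) * (u - v) by rewrite mulr_ge0 // subr_ge0 // ltW.
  lra.
by split; exact: conv.
Qed.

Lemma reachable_segment (P : set S) z N g a b : parametrized_box z N g -> box a -> box b ->
  (forall s : R, 0 <= s <= 1 -> ~ P (g (a.1 + s * (b.1 - a.1), a.2 + s * (b.2 - a.2)))) ->
  reachable R P (g a) (g b).
Proof.
move=> gP ba bb sP.
pose k (s : I) := (a.1 + val s * (b.1 - a.1), a.2 + val s * (b.2 - a.2)).
have s01 (s : I) : 0 <= val s <= 1 by rewrite itv_ge0 itv_le1.
have ck : continuous k.
  apply: (@continuous_pair I R R (fun s => a.1 + val s * (b.1 - a.1))
    (fun s => a.2 + val s * (b.2 - a.2))).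
    by have := @shift_continuous R (b.1 - a.1) a.1; under eq_fun do rewrite addrC mulrC.
  by have := @shift_continuous R (b.2 - a.2) a.2; under eq_fun do rewrite addrC mulrC.
have cgk : continuous (g \o k).
  move=> s; apply: continuous_comp; first exact: ck.
  by apply: (box_continuous gP); exact: box_convex.
have k0 : (g \o k) zero = g a by rewrite /= /k val_zero !mul0r !addr0; case: (a).
have k1 : (g \o k) one = g b.
  by rewrite /= /k val_one !mul1r ![_ + (_ - _)]addrC !subrK; case: (b).
by exists (mk_path cgk k0 k1) => s; exact: sP.
Qed.

(** A segment avoids the origin unless its ends are collinear with it; in that
case, go through the first end rotated by a right angle. *)
Lemma reachable_punctured_box (P : set S) z g a b :
  parametrized_box z [set y | P y -> y = z] g ->
  box a -> box b -> a <> (0, 0) -> b <> (0, 0) -> reachable R P (g a) (g b).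
Proof.
move=> gP.
have b0 : box (0, 0) by split; rewrite /= normr0 ltr01.
have noncollinear u v : box u -> box v -> u.1 * v.2 - u.2 * v.1 <> 0 ->
    reachable R P (g u) (g v).
  move=> bu bv uv; apply: (reachable_segment gP bu bv) => s s01 Pg.
  have bs := box_convex bu bv s01.
  have := box_inside gP bs Pg; rewrite -(box_center gP) => /(box_inj gP bs b0)[e1 e2].
  apply: uv.
  have [s1|s1] := eqVneq s 1.
    move: e1 e2; rewrite s1 !mul1r ![_ + (_ - _)]addrC !subrK => -> ->; ring.
  have /eqP s1' : 1 - s != 0 by rewrite subr_eq0 eq_sym.
  apply/eqP; rewrite -(mulrI_eq0 _ (mulfI (introN eqP s1'))); apply/eqP.
  transitivity ((u.1 + s * (v.1 - u.1)) * v.2 - (u.2 + s * (v.2 - u.2)) * v.1); first by ring.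
  by rewrite e1 e2 !mul0r subrr.
move=> ba bb /eqP a0 /eqP b0'.
have [ab|/eqP ab] := eqVneq (a.1 * b.2 - a.2 * b.1) 0; last exact: noncollinear.
have norm_neq0 (u : R * R) : u != (0, 0) -> u.1 ^+ 2 + u.2 ^+ 2 != 0.
  apply: contraNneq => /eqP; rewrite paddr_eq0 ?sqr_ge0 // !sqrf_eq0.
  by case: u => u1 u2 /= /andP[/eqP -> /eqP ->].
have bc : box (- a.2, a.1) by case: ba => a1 a2; split; rewrite //= normrN.
apply: (@reachable_trans _ _ _ (g (- a.2, a.1))).
  apply: noncollinear => //=; apply/eqP.
  by have := norm_neq0 _ a0; congr (_ != _); ring.
apply: noncollinear => //= ab'.
have /eqP : (a.1 ^+ 2 + a.2 ^+ 2) * (b.1 ^+ 2 + b.2 ^+ 2) = 0.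
  transitivity ((a.1 * b.2 - a.2 * b.1) ^+ 2 + (- a.2 * b.2 - a.1 * b.1) ^+ 2); first by ring.
  by rewrite ab ab' expr0n addr0.
by rewrite mulf_eq0 (negbTE (norm_neq0 _ a0)) (negbTE (norm_neq0 _ b0')).
Qed.

(** The closure of the set of points that can be reached from [a] outside [P] is
open: near each of its points, all points outside [P] can be reached through a
box, punctured when its center is in [P]. *)
Lemma reachable_complement (P : set S) :
  (forall z, nbhs z [set y | P y -> y = z]) ->
  forall a b, ~ P a -> ~ P b -> reachable R P a b.
Proof.
move=> iso a b Pa Pb.
pose A := closure [set y | reachable R P a y].
have Aa : A a by apply: subset_closure; exact: reachable_refl.
have local z : A z -> nbhs z [set y | ~ P y -> reachable R P a y].
  move=> Az; have [g gP] := parametrized_box_exists (iso z).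
  have [y [ay [u bu uy]]] := Az _ (box_nbhs gP); subst y.
  have b0 : box (0, 0) by split; rewrite /= normr0 ltr01.
  have [Pz|Pz] := pselect (P z); last first.
    apply: filterS (box_nbhs gP) => _ [v bv <-] _.
    apply: reachable_trans ay _; apply: (reachable_segment gP bu bv) => s s01 Pg.
    have := box_inside gP (box_convex bu bv s01) Pg => gz; apply: Pz.
    by rewrite -gz.
  have u0 : u <> (0, 0).
    move=> u0; case: ay => p /(_ one); rewrite path_one u0 (box_center gP); exact.
  apply: filterS (box_nbhs gP) => _ [v bv <-] Pv.
  apply: reachable_trans ay _; apply: (reachable_punctured_box gP) => // v0.
  by apply: Pv; rewrite v0 (box_center gP).
suff AT : A = setT.
  have /local/nbhs_singleton : A b by rewrite AT.
  exact.
apply: (surface_connected S_surface); first by exists a.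
- exists A; last by rewrite setTI.
  rewrite openE => z Az; have [g gP] := parametrized_box_exists (iso z).
  apply: filterS (filterI (local _ Az) (iso z)) => y /= [ay yz].
  have [Py|Py] := pselect (P y); first by rewrite yz.
  by apply: subset_closure; exact: ay.
- by exists A; [exact: closed_closure|rewrite setTI].
Qed.

Variable n : nat.
Local Notation conf := (configuration_space S n).

Lemma isolated_family (J : finType) (f : J -> S) z :
  nbhs z [set y | forall j, f j <> z -> f j <> y].
Proof.
apply: (@filter_forall S J (fun j y => f j <> z -> f j <> y) (nbhs z)) => j.
have [->|fz] := pselect (f j = z); first by apply: nearW.
have : nbhs z (~` [set f j]).
  apply: open_nbhs_nbhs; split; last by move=> /= /esym.
  rewrite openC; apply: accessible_closed_set1.
  exact: hausdorff_accessible (surface_hausdorff S_surface).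
by apply: filterS => y yf _ fy; apply: yf.
Qed.

(** Move the [i]-th point in the complement of the others. *)
Lemma move_point (e e' : conf) i :
  (forall j, j != i -> point_at e j = point_at e' j) ->
  inhabited {path I from e to e'}.
Proof.
move=> ee'.
pose P : set S := [set y | exists2 j, j != i & y = point_at e j].
have Pi (f : conf) : (forall j, j != i -> point_at f j = point_at e j) -> ~ P (point_at f i).
  by move=> fe [j ji]; rewrite -fe // => /esym; apply: point_at_neq; apply/eqP.
have [|||p pP] := @reachable_complement P _ (point_at e i) (point_at e' i).
- move=> z; apply: filterS (isolated_family (point_at e) z) => y yP [j ji yj].
  by apply: contrapT; rewrite yj => jz; exact: (yP j).
- exact: Pi.
- by apply: Pi => j ji; rewrite ee'.
pose f (s : I) j := if j == i then p s else point_at e j.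
have fP s j k : j <> k -> f s j <> f s k.
  rewrite /f; case: eqP => [->|/eqP ji]; case: eqP => [->|/eqP ki] // jk.
  - by move=> pk; apply: (pP s); exists k.
  - by move=> pj; apply: (pP s); exists j.
  - exact: point_at_neq.
have cf : continuous (fun s => configuration (@fP s)).
  apply: configuration_continuous => j; rewrite /point_at /= /f.
  case: (j == i); [exact: path_continuous|exact: cst_continuous].
have f0 : configuration (@fP zero) = e.
  apply: point_at_ext => j; rewrite /point_at /= /f; case: eqP => // ->.
  exact: path_zero.
have f1 : configuration (@fP one) = e'.
  apply: point_at_ext => j; rewrite /point_at /= /f.
  by case: eqVneq => [->|ji]; [exact: path_one|exact: ee'].
pose p' : {path I from e to e'} := mk_path cf f0 f1.
exact: (inhabits p').
Qed.

End surface_paths.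

(** * A rotating triple of points in the plane *)

Section rotating_triple.
Variable R : realType.
Local Notation plane := (R * R)%type.

Definition clamped (t : R) : R := val (clamp t).
Arguments clamped : simpl never.

Lemma clamped0 : clamped 0 = 0. Proof. exact: val_zero. Qed.
Lemma clamped1 : clamped 1 = 1. Proof. exact: val_one. Qed.

Lemma clamped_itv t : 0 <= clamped t <= 1.
Proof. by rewrite /clamped itv_ge0 itv_le1. Qed.

(** The apex angle increases from [pi / 2], where the triple is collinear, to
[2 * pi / 3], where it is an equilateral triangle. *)
Definition apex_angle (t : R) : R := pi / 2 + clamped t * (pi / 6).

(** The coordinate [z.1] is the angle by which the triple is turned; the
coordinate [z.2], clamped to the unit interval, is the time of the deformation
from the collinear triple to the triangle.  In polar form a turn is a shift of
the angle.  The radius 1/2 keeps the triple inside the unit box. *)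
Definition triple_point (k : nat) (z : plane) : plane :=
  match k with
  | 0 => polar (clamped z.2 / 2) z.1
  | 1 => polar 2^-1 (z.1 + apex_angle z.2)
  | _ => polar 2^-1 (z.1 - apex_angle z.2)
  end.

Lemma sin_apex_gt0 t : 0 < sin (apex_angle t).
Proof.
have := clamped_itv t; have := pi_gt0 R => p0 t01.
have [t0 t1] := andP t01.
have h0 : 0 <= clamped t * (pi / 6) by rewrite mulr_ge0 // divr_ge0 // ltW.
have h1 : 0 <= (1 - clamped t) * (pi / 6).
  by rewrite mulr_ge0 ?subr_ge0 // divr_ge0 // ltW.
by apply: sin_gt0_pi; rewrite /apex_angle; lra.
Qed.

Lemma polar_box r t : 0 <= r <= 2^-1 -> @box R (polar r t).
Proof.
move=> r01; have [r0 r1] := andP r01; rewrite /box /polar /= !normrM (ger0_norm r0).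
have half : 2^-1 < 1 :> R by lra.
split; apply: (le_lt_trans _ half); apply: le_trans r1; rewrite ler_piMr //.
  exact: cos_max.
exact: sin_max.
Qed.

Lemma triple_point_box k z : @box R (triple_point k z).
Proof.
have := clamped_itv z.2 => t01.
by case: k => [|[|k]]; apply: polar_box; lra.
Qed.

Lemma polar_eq_sin r r' (u v : R) : polar r u = polar r' v -> r' * sin (v - u) = 0.
Proof.
case=> ec es; rewrite sinB.
transitivity ((r' * sin v) * cos u - (r' * cos v) * sin u); first by ring.
by rewrite -ec -es; ring.
Qed.

(** Two points of the triple coincide only if the sine of the apex angle
vanishes. *)
Lemma triple_point_inj k l z : (k < 3)%N -> (l < 3)%N ->
  triple_point k z = triple_point l z -> k = l.
Proof.
have s0 := lt0r_neq0 (sin_apex_gt0 z.2).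
have half : 2^-1 != 0 :> R by rewrite invr_eq0 pnatr_eq0.
have c0 : cos (apex_angle z.2) * 0 = 0 by rewrite mulr0.
have P01 : triple_point 0 z <> triple_point 1 z.
  move/polar_eq_sin/eqP; rewrite [_ + apex_angle _]addrC addrK.
  by rewrite mulf_eq0 (negbTE half) (negbTE s0).
have P02 : triple_point 0 z <> triple_point 2 z.
  move/polar_eq_sin/eqP; rewrite addrAC subrr add0r sinN.
  by rewrite mulf_eq0 oppr_eq0 (negbTE half) (negbTE s0).
have P12 : triple_point 1 z <> triple_point 2 z.
  case=> /(mulfI half) ec /(mulfI half) es.
  move: ec es; rewrite cosD cosB sinD sinB.
  set C := cos z.1; set s := sin z.1; set A := cos _; set D := sin _ => ec es.
  have : D * (C ^+ 2 + s ^+ 2) = 0.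
    have -> : D * (C ^+ 2 + s ^+ 2) = ((s * A + C * D) - (s * A - C * D)) / 2 * C
      - ((C * A - s * D) - (C * A + s * D)) / 2 * s by field.
    by rewrite ec es !subrr !mul0r subrr.
  by rewrite cos2Dsin2 mulr1 => /eqP; rewrite (negbTE s0).
case: k => [|[|[|k]]] //; case: l => [|[|[|l]]] // _ _ /esym e; by [].
Qed.

Lemma polar_continuous (Z : topologicalType) (r t : Z -> R) :
  continuous r -> continuous t -> continuous (fun z => polar (r z) (t z)).
Proof.
move=> cr ct.
have cc := continuous_compose ct (@continuous_cos R).
have cs := continuous_compose ct (@continuous_sin R).
apply: (@continuous_pair Z R R (fun z => r z * cos (t z)) (fun z => r z * sin (t z))) => z.
  by apply: cvgM; [exact: cr|exact: cc].
by apply: cvgM; [exact: cr|exact: cs].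
Qed.

Lemma triple_point_continuous k : continuous (triple_point k).
Proof.
have cc : continuous (fun z : plane => clamped z.2).
  have c1 := continuous_compose (@snd_continuous R R) (@clamp_continuous R).
  exact: continuous_compose c1 (@val_itv_continuous R).
have ca : continuous (fun z : plane => apex_angle z.2).
  move=> z; apply: cvgD; first exact: cvg_cst.
  by apply: cvgM; [exact: cc|exact: cvg_cst].
case: k => [|[|k]]; apply: polar_continuous.
- by move=> z; apply: cvgM; [exact: cc|exact: cvg_cst].
- exact: fst_continuous.
- exact: cst_continuous.
- by move=> z; apply: cvgD; [exact: fst_continuous|exact: ca].
- exact: cst_continuous.
- by move=> z; apply: cvgB; [exact: fst_continuous|exact: ca].
Qed.

Lemma polar_2pi r (t : R) : polar r (t + (pi + pi)) = polar r t.
Proof. by rewrite /polar addrA !cosDpi !sinDpi !opprK. Qed.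

Lemma triple_point_full_turn k s t :
  triple_point k (s + (pi + pi), t) = triple_point k (s, t).
Proof. by case: k => [|[|k]] /=; rewrite ?(addrAC s (pi + pi)) polar_2pi. Qed.

Definition half_turn_index (k : nat) : nat :=
  match k with 1 => 2 | 2 => 1 | _ => k end.

Definition third_turn_index (k : nat) : nat :=
  match k with 0 => 1 | 1 => 2 | 2 => 0 | _ => k end.

Lemma apex_angle0 : apex_angle 0 = pi / 2.
Proof. by rewrite /apex_angle clamped0 mul0r addr0. Qed.

Lemma apex_angle1 : apex_angle 1 = pi *+ 2 / 3.
Proof. by rewrite /apex_angle clamped1 mul1r; field. Qed.

Lemma triple_point_half_turn k s : (k < 3)%N ->
  triple_point k (s + pi, 0) = triple_point (half_turn_index k) (s, 0).
Proof.
case: k => [|[|[|k]]] //= _.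
- by rewrite /polar clamped0 !mul0r.
- by rewrite apex_angle0 -[RHS]polar_2pi; congr polar; field.
- by rewrite apex_angle0; congr polar; field.
Qed.

Lemma triple_point_third_turn k s : (k < 3)%N ->
  triple_point k (s + pi *+ 2 / 3, 1) = triple_point (third_turn_index k) (s, 1).
Proof.
case: k => [|[|[|k]]] //= _.
- by rewrite apex_angle1 clamped1 mul1r.
- by rewrite apex_angle1 -[RHS]polar_2pi; congr polar; field.
- by rewrite apex_angle1 clamped1 mul1r; congr polar; field.
Qed.

End rotating_triple.

(** * The rotating triple in a surface *)

Section rotating_configuration.
Variables (R : realType) (S : topologicalType) (S_surface : surface R S).
Variables (n : nat) (n_ge3 : (3 <= n)%N).
Local Notation I := (unit_interval R).
Local Notation conf := (configuration_space S n).
Local Notation orb := (orbit_space S n).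
Local Notation pr := (\pi_orb : conf -> orb).

Definition index0 : 'I_n := Ordinal (leq_trans (isT : 0 < 3)%N n_ge3).
Definition index1 : 'I_n := Ordinal (leq_trans (isT : 1 < 3)%N n_ge3).
Definition index2 : 'I_n := Ordinal (leq_trans (isT : 2 < 3)%N n_ge3).

Definition swap12 : 'S_n := tperm index1 index2.
Definition cycle012 : 'S_n := (tperm index0 index1 * tperm index0 index2)%g.

Lemma swap12E (i : 'I_n) : swap12 i = half_turn_index i :> nat.
Proof.
rewrite /swap12; case: tpermP => [->|->|] //.
by case: i => [[|[|[|i]]] ilt] // i1 i2; [case: i1|case: i2]; apply: val_inj.
Qed.

Lemma cycle012E (i : 'I_n) : cycle012 i = third_turn_index i :> nat.
Proof.
rewrite /cycle012 permM; case: (tpermP index0 index1 i) => [->|->|].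
- by rewrite tpermD // -val_eqE.
- by rewrite tpermL.
case: i => [[|[|[|i]]] ilt] // i0 i1.
- by case: i0; exact: val_inj.
- by case: i1; exact: val_inj.
- by rewrite (_ : Ordinal ilt = index2) ?tpermR //; exact: val_inj.
by rewrite tpermD // -val_eqE.
Qed.

(** The two products differ on the point of index 0. *)
Lemma swap_cycle_neq : (swap12 * cycle012 <> cycle012 * swap12)%g.
Proof.
move/permP/(_ index0)/(congr1 (@nat_of_ord n)).
rewrite (permM swap12 cycle012) (permM cycle012 swap12).
by rewrite cycle012E !swap12E cycle012E.
Qed.

Variables (e : conf) (g : R * R -> S).
(* The box centered at the first point of [e] contains no other point of [e]. *)
Hypothesis gP : parametrized_box (point_at e index0)
  [set y | forall j, j != index0 -> point_at e j <> y] g.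

Definition rotating_point (z : R * R) (i : 'I_n) : S :=
  if (i < 3)%N then g (triple_point i z) else point_at e i.

Lemma rotating_point_neq z i j : i <> j -> rotating_point z i <> rotating_point z j.
Proof.
have away (k l : 'I_n) : (k < 3)%N -> ~~ (l < 3)%N ->
    g (triple_point k z) <> point_at e l.
  move=> k3 l3 /esym; apply: (box_inside gP (triple_point_box k z)).
  by apply: contraNneq l3 => ->.
rewrite /rotating_point => ij.
case: ifPn => i3; case: ifPn => j3.
- move/(box_inj gP (triple_point_box i z) (triple_point_box j z)).
  by move/(triple_point_inj i3 j3)/val_inj.
- exact: away.
- by move/esym; exact: away.
- exact: point_at_neq.
Qed.

Definition rotating (z : R * R) : conf := configuration (@rotating_point_neq z).

Lemma point_at_rotating z i : point_at (rotating z) i = rotating_point z i.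
Proof. by []. Qed.

Lemma rotating_continuous : continuous rotating.
Proof.
apply: configuration_continuous => i.
change (continuous (fun z => rotating_point z i)).
rewrite /rotating_point; case: (i < 3)%N; last exact: cst_continuous.
move=> z; apply: (@continuous_comp _ _ _ (triple_point i) g).
  exact: triple_point_continuous.
by apply: (box_continuous gP); exact: triple_point_box.
Qed.

Lemma rotating_half_turn s : rotating (s + pi, 0) = relabel swap12 (rotating (s, 0)).
Proof.
apply: point_at_ext => i; rewrite point_at_relabel !point_at_rotating /rotating_point.
rewrite swap12E; case: ltnP => i3; first rewrite triple_point_half_turn //.
  by case: (i : nat) i3 => [|[|[|]]].
rewrite (_ : swap12 i = i); last first.
  by apply: val_inj; rewrite /= swap12E; case: (i : nat) i3 => [|[|[|]]].
by case: (i : nat) i3 => [|[|[|]]].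
Qed.

Lemma rotating_third_turn s :
  rotating (s + pi *+ 2 / 3, 1) = relabel cycle012 (rotating (s, 1)).
Proof.
apply: point_at_ext => i; rewrite point_at_relabel !point_at_rotating /rotating_point.
rewrite cycle012E; case: ltnP => i3; first rewrite triple_point_third_turn //.
  by case: (i : nat) i3 => [|[|[|]]].
rewrite (_ : cycle012 i = i); last first.
  by apply: val_inj; rewrite /= cycle012E; case: (i : nat) i3 => [|[|[|]]].
by case: (i : nat) i3 => [|[|[|]]].
Qed.

Lemma rotating_full_turn t : rotating (pi + pi, t) = rotating (0, t).
Proof.
apply: point_at_ext => i; rewrite !point_at_rotating /rotating_point.
by rewrite -[pi + pi]add0r triple_point_full_turn.
Qed.

(** The first point of [e] is already at the center of the box.  The second and
the third one are moved in turn; the target of the second one is in the box, so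
it differs from the initial position of the third one. *)
Lemma path_to_rotating : inhabited {path I from e to rotating (0, 0)}.
Proof.
have e0 : point_at (rotating (0, 0)) index0 = point_at e index0.
  rewrite point_at_rotating /rotating_point /= -(box_center gP).
  by rewrite /polar clamped0 !mul0r.
have far k : (3 <= k)%N -> forall kn : (k < n)%N,
    point_at (rotating (0, 0)) (Ordinal kn) = point_at e (Ordinal kn).
  by move=> k3 kn; rewrite point_at_rotating /rotating_point /= ltnNge k3.
pose f (j : 'I_n) := if j == index1 then point_at (rotating (0, 0)) j else point_at e j.
have f1 j : j != index1 -> point_at (rotating (0, 0)) index1 <> point_at e j.
  move=> j1; have [->|j0] := eqVneq j index0.
    by rewrite -e0; apply: point_at_neq.
  rewrite point_at_rotating /rotating_point /= => /esym.
  by apply: (box_inside gP (triple_point_box 1 (0, 0))).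
have fP i j : i <> j -> f i <> f j.
  rewrite /f; case: eqVneq => [->|i1]; case: eqVneq => [->|j1] // ij.
  - exact: f1.
  - by move/esym; exact: f1.
  - exact: point_at_neq.
have [|p] := @move_point R S S_surface n e (configuration fP) index1.
  by move=> j j1; rewrite {2}/point_at /= /f (negbTE j1).
have [|q] := @move_point R S S_surface n (configuration fP) (rotating (0, 0)) index2.
  move=> j j2; rewrite {1}/point_at /= /f; case: eqVneq => // j1.
  case: j j1 j2 => [[|[|[|k]]] kn] j1 j2.
  - by rewrite (_ : Ordinal kn = index0) ?e0 //; exact: val_inj.
  - by case/eqP: j1; exact: val_inj.
  - by case/eqP: j2; exact: val_inj.
  - by rewrite far.
exact: (inhabits (concat p q)).
Qed.

Lemma sq_cube_noncommuting (x : orb) : pr e = x ->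
  exists a b : fundamental_group R x, (a ^+ 2 = b ^+ 3 /\ ~ commute a b)%g.
Proof.
move=> ex; pose H (z : R * R) := pr (rotating z).
have cH : continuous H by exact: continuous_compose rotating_continuous (@pi_continuous _ _).
have H_half s : H (s + pi, 0) = H (s, 0).
  by rewrite /H rotating_half_turn orbit_relabel.
have H_third s : H (s + pi *+ 2 / 3, 1) = H (s, 1).
  by rewrite /H rotating_third_turn orbit_relabel.
have line (u v : R) : continuous (fun s : I => (u * val s, v)).
  exact: continuous_compose (@Defs.scale_continuous R u) (@pairl_continuous _ _ v).
have cw : continuous (fun s : I => (0 : R, val s)).
  exact: continuous_compose (@val_itv_continuous R) (@pairr_continuous _ _ 0).
have cp' := continuous_compose (line pi 0) rotating_continuous.
have p'0 : rotating (pi * val (zero : I), 0) = rotating (0, 0) by rewrite val_zero mulr0.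
have p'1 : rotating (pi * val (one : I), 0) = relabel swap12 (rotating (0, 0)).
  by rewrite val_one mulr1 -rotating_half_turn add0r.
pose p' : {path I from _ to _} := mk_path cp' p'0 p'1.
have cq' := continuous_compose (line (pi *+ 2 / 3) 1) rotating_continuous.
have q'0 : rotating (pi *+ 2 / 3 * val (zero : I), 1) = rotating (0, 1).
  by rewrite val_zero mulr0.
have q'1 : rotating (pi *+ 2 / 3 * val (one : I), 1) = relabel cycle012 (rotating (0, 1)).
  by rewrite val_one mulr1 -rotating_third_turn add0r.
pose q' : {path I from _ to _} := mk_path cq' q'0 q'1.
have cw' := continuous_compose cw rotating_continuous.
have w'0 : rotating (0, val (zero : I)) = rotating (0, 0) by rewrite val_zero.
have w'1 : rotating (0, val (one : I)) = rotating (0, 1) by rewrite val_one.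
pose w' : {path I from _ to _} := mk_path cw' w'0 w'1.
have project (c d : conf) (u v : orb) (r : {path I from c to d}) : pr c = u -> pr d = v ->
    exists r' : {path I from u to v}, lifts_path pr r' r.
  move=> cu dv.
  have cr := continuous_compose (@path_continuous _ _ _ _ r)
    (@pi_continuous _ _ : continuous pr).
  have r0 : pr (r zero) = u by rewrite path_zero.
  have r1 : pr (r one) = v by rewrite path_one.
  by exists (mk_path cr r0 r1).
have [p pP] := project _ _ (H (0, 0)) (H (0, 0)) p' erefl (orbit_relabel _ _).
have [q qP] := project _ _ (H (0, 1)) (H (0, 1)) q' erefl (orbit_relabel _ _).
have [w wP] := project _ _ (H (0, 0)) (H (0, 1)) w' erefl erefl.
have [c'] := path_to_rotating.
have [c cP] := project _ _ x (H (0, 0)) c' ex erefl.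
pose a := \pi_(fundamental_group R (H (0, 0))) p.
pose b := base_change w (\pi_(fundamental_group R (H (0, 1))) q).
have ab : (a ^+ 2 = b ^+ 3)%g.
  apply: (half_turn_third_turn cH _ _ _ _ H_half H_third).
  - by field.
  - by move=> s; rewrite -pP.
  - by move=> s; rewrite -qP.
  - by move=> s; rewrite -wP.
  - by move=> t; rewrite /H rotating_full_turn.
have aP : permutes (rotating (0, 0)) a swap12 by exists p, p'.
have bP : permutes (rotating (0, 0)) b cycle012.
  by apply: permutes_base_change wP _; exists q, q'.
exists (base_change c a), (base_change c b); split.
  by rewrite -!(multiplicativeX (base_change c)) ab.
move=> cab; apply: swap_cycle_neq.
have {}aP := permutes_base_change cP aP; have {}bP := permutes_base_change cP bP.
apply: (permutes_unique (surface_hausdorff S_surface) (permutes_mul aP bP)).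
by rewrite cab; exact: permutes_mul.
Qed.

End rotating_configuration.

Theorem mainTheorem7 (R : realType) (S : topologicalType)
    (S_surface : surface R S) (S_orientable : orientable R S)
    (n : nat) (n_ge3 : (3 <= n)%N) (x : orbit_space S n) :
  ~ residually_free (surface_braid_group R x).
Proof.
have ex : \pi_(orbit_space S n) (repr x) = x by exact: reprK.
have near0 : nbhs (point_at (repr x) (index0 n_ge3))
    [set y | forall j, j != index0 n_ge3 -> point_at (repr x) j <> y].
  apply: filterS (isolated_family S_surface (point_at (repr x)) _) => y yP j j0.
  by apply: yP; apply: point_at_neq; apply/eqP.
have [g gP] := parametrized_box_exists S_surface near0.
have [a [b [ab nab]]] := sq_cube_noncommuting S_surface gP ex.
by move=> Gfree; apply: nab; exact: residually_free_sq_cube_commute Gfree ab.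
Qed.
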